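(* Suppose there exist an integer $\ell\geq 1$ and a constant $\epsilon>0$ such that at least one of the following problems, on $n$-node graphs with $m=\Theta(n^{1+1/\ell})$ edges and integer edge weights, can be solved in $O(mn^{1-\epsilon}+n^2)$ time: (i) Minimum Weight $(2\ell+1)$-Cycle in a directed weighted graph; (ii) Shortest Cycle in a directed weighted graph. Then the Min Weight $(2\ell+1)$-Clique Hypothesis is false.
   Context: Computational model: Word-RAM with $O(\log n)$-bit words. Minimum Weight $k$-Cycle: given a directed graph with integer edge weights, find a simple directed cycle on exactly $k$ vertices of minimum total edge weight. Shortest Cycle: given a directed graph with integer edge weights, find a directed cycle of minimum total weight. Min Weight $k$-Clique Hypothesis: there is a constant $c>1$ such that, on a Word-RAM with $O(\log n)$-bit words, finding a $k$-clique of minimum total edge weight in an $n$-node graph with nonnegative integer edge weights in $[1,n^{ck}]$ requires $n^{k-o(1)}$ time. *)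

(* Defs.v *)
From Stdlib Require Import Reals ZArith List.
Import ListNotations.

(** * Word-RAM *)

(* A word of the w-bit machine is an integer in [0, 2^w).  Every result is
   reduced modulo 2^w, so signed quantities appear in two's complement. *)
Definition wrap (w : nat) (z : Z) : Z := (z mod 2 ^ Z.of_nat w)%Z.

Inductive binop : Set :=
  | OAdd | OSub | OMul | ODiv | OMod | OAnd | OOr | OXor | OShl | OShr | OLt | OEq.

Definition eval_binop (o : binop) (x y : Z) : Z :=
  match o with
  | OAdd => x + y
  | OSub => x - y
  | OMul => x * y
  | ODiv => x / y
  | OMod => x mod y
  | OAnd => Z.land x y
  | OOr => Z.lor x y
  | OXor => Z.lxor x y
  | OShl => Z.shiftl x y
  | OShr => Z.shiftr x y
  | OLt => Z.b2z (x <? y)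
  | OEq => Z.b2z (x =? y)
  end%Z.

(* Registers are named by natural numbers; a program mentions only finitely many
   of them.  Memory is addressed by words, through registers. *)
Inductive instr : Set :=
  | IConst (dst : nat) (c : Z)
  | IOp (o : binop) (dst src1 src2 : nat)
  | ILoad (dst addr : nat)
  | IStore (addr src : nat)
  | IJump (target : nat)
  | IJumpIfZero (r target : nat).

Definition program : Set := list instr.

Record state : Set := State { pc : nat; regs : nat -> Z; mem : Z -> Z }.

Definition set_reg (f : nat -> Z) (r : nat) (v : Z) : nat -> Z :=
  fun r' => if Nat.eqb r' r then v else f r'.

Definition set_mem (f : Z -> Z) (a : Z) (v : Z) : Z -> Z :=
  fun a' => if Z.eqb a' a then v else f a'.

Definition exec_instr (w : nat) (i : instr) (s : state) : state :=
  let (p, r, m) := s in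
  match i with
  | IConst dst c => State (S p) (set_reg r dst (wrap w c)) m
  | IOp o dst src1 src2 =>
      State (S p) (set_reg r dst (wrap w (eval_binop o (r src1) (r src2)))) m
  | ILoad dst addr => State (S p) (set_reg r dst (m (r addr))) m
  | IStore addr src => State (S p) r (set_mem m (r addr) (r src))
  | IJump target => State target r m
  | IJumpIfZero r0 target => State (if Z.eqb (r r0) 0 then target else S p) r m
  end.

(* The machine halts when the program counter leaves the program; halted states
   are fixed by [step]. *)
Definition halted (P : program) (s : state) : Prop := length P <= pc s.

Definition step (w : nat) (P : program) (s : state) : state :=
  match nth_error P (pc s) with
  | Some i => exec_instr w i s
  | None => s
  end.

Definition run (w : nat) (P : program) (t : nat) (s : state) : state :=
  Nat.iter t (step w P) s.

Definition init_state (w : nat) (input : list Z) : state :=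
  State 0 (fun _ => 0%Z)
    (fun a => if Z.ltb a 0 then 0%Z else wrap w (nth (Z.to_nat a) input 0%Z)).

(* The output is a list of numbers, in cells 1, ..., L where L is the content of
   cell 0. *)
Definition output (s : state) : list nat :=
  map (fun i => Z.to_nat (mem s (Z.of_nat i))) (seq 1 (Z.to_nat (mem s 0%Z))).

(** * Weighted graphs *)

(* Vertices are 0, ..., order - 1. *)
Record wgraph : Set := WGraph { order : nat; edges : list (nat * nat * Z) }.

Definition num_edges (G : wgraph) : nat := length (edges G).

Definition encode (G : wgraph) : list Z :=
  Z.of_nat (order G) :: Z.of_nat (num_edges G) ::
  flat_map (fun e => let '(u, v, x) := e in [Z.of_nat u; Z.of_nat v; x]) (edges G).

(* Simple digraphs: no loops and no parallel arcs, but antiparallel arcs allowed. *)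
Definition is_digraph (G : wgraph) : Prop :=
  (forall u v x, In (u, v, x) (edges G) -> u < order G /\ v < order G /\ u <> v) /\
  NoDup (map fst (edges G)).

(* Simple undirected graphs: each edge is listed once, smaller endpoint first. *)
Definition is_ugraph (G : wgraph) : Prop :=
  (forall u v x, In (u, v, x) (edges G) -> u < v /\ v < order G) /\
  NoDup (map fst (edges G)).

Definition arc (G : wgraph) (u v : nat) : Prop := In (u, v) (map fst (edges G)).

(* The junk value 0 is used when (u, v) is not an arc. *)
Definition arc_weight (G : wgraph) (u v : nat) : Z :=
  match find (fun e => Nat.eqb (fst (fst e)) u && Nat.eqb (snd (fst e)) v)%bool
             (edges G) with
  | Some e => snd e
  | None => 0%Z
  end.

Definition sumZ (l : list Z) : Z := fold_right Z.add 0%Z l.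

(* [v_1; ...; v_L] stands for the cycle v_1 -> v_2 -> ... -> v_L -> v_1. *)
Definition cycle_arcs (s : list nat) : list (nat * nat) :=
  combine s (tl s ++ firstn 1 s).

Definition directed_cycle (G : wgraph) (s : list nat) : Prop :=
  s <> [] /\ NoDup s /\ Forall (fun p => arc G (fst p) (snd p)) (cycle_arcs s).

Definition cycle_weight (G : wgraph) (s : list nat) : Z :=
  sumZ (map (fun p => arc_weight G (fst p) (snd p)) (cycle_arcs s)).

Definition uadj (G : wgraph) (u v : nat) : Prop := arc G (Nat.min u v) (Nat.max u v).

Definition uweight (G : wgraph) (u v : nat) : Z :=
  arc_weight G (Nat.min u v) (Nat.max u v).

Definition clique (G : wgraph) (k : nat) (s : list nat) : Prop :=
  length s = k /\ NoDup s /\ Forall (fun v => v < order G) s /\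
  ForallOrdPairs (uadj G) s.

Fixpoint clique_weight (G : wgraph) (s : list nat) : Z :=
  match s with
  | [] => 0%Z
  | v :: s' => (sumZ (map (uweight G v) s') + clique_weight G s')%Z
  end.

(** * Problems and running times *)

(* [out] is a feasible solution of minimum weight, or the empty list if there is
   no feasible solution. *)
Definition min_solution (feasible : list nat -> Prop) (weight : list nat -> Z)
    (out : list nat) : Prop :=
  (feasible out /\ forall s, feasible s -> (weight out <= weight s)%Z) \/
  (out = [] /\ forall s, ~ feasible s).

(* O(log n)-bit words: for n >= 1, S (Nat.log2 n) is the number of bits of n. *)
Definition word_size (C n : nat) : nat := C * S (Nat.log2 n).

(* A single program, on a machine with words of O(log n) bits, gives a correct
   output on every instance in time O(T). *)
Definition solvable_in_O (instance : wgraph -> Prop)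
    (correct : wgraph -> list nat -> Prop) (T : wgraph -> R) : Prop :=
  exists (P : program) (C : nat) (K : R),
  forall G : wgraph, 1 <= order G -> instance G ->
  let w := word_size C (order G) in
  exists t : nat,
    (INR t <= K * T G)%R /\
    halted P (run w P t (init_state w (encode G))) /\
    correct G (output (run w P t (init_state w (encode G)))).

(* Real exponents; only used for n >= 1. *)
Definition npow (n : nat) (x : R) : R := Rpower (INR n) x.

Definition min_weight_k_clique_hypothesis (k : nat) : Prop :=
  exists c : R, (1 < c)%R /\
  forall delta : R, (0 < delta)%R ->
  ~ solvable_in_O
      (fun G => is_ugraph G /\
         forall u v x, In (u, v, x) (edges G) ->
           (1 <= x)%Z /\ (IZR x <= npow (order G) (c * INR k))%R)
      (fun G => min_solution (clique G k) (clique_weight G))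
      (fun G => npow (order G) (INR k - delta)).

(* n-node digraphs with a n^(1+1/l) <= m <= b n^(1+1/l) arcs and integer weights of
   absolute value at most n^d, i.e. of O(log n) bits. *)
Definition sparse_digraph (l : nat) (a b : R) (d : nat) (G : wgraph) : Prop :=
  is_digraph G /\
  (a * npow (order G) (1 + 1 / INR l) <= INR (num_edges G)
     <= b * npow (order G) (1 + 1 / INR l))%R /\
  forall u v x, In (u, v, x) (edges G) -> (Z.abs x <= Z.of_nat (order G) ^ Z.of_nat d)%Z.

Definition target_time (eps : R) (G : wgraph) : R :=
  (INR (num_edges G) * npow (order G) (1 - eps) + INR (order G) ^ 2)%R.

(* The constants of m = Theta(n^(1+1/l)) and the degree of the polynomial weight
   bound are arbitrary; the program and the constants of its word size and running
   time may depend on them, eps may not. *)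
Definition min_weight_k_cycle_fast (k l : nat) (eps : R) : Prop :=
  forall (a b : R) (d : nat), (0 < a)%R -> (a <= b)%R ->
  solvable_in_O
    (sparse_digraph l a b d)
    (fun G => min_solution (fun s => directed_cycle G s /\ length s = k) (cycle_weight G))
    (target_time eps).

(* As usual for shortest-path problems, inputs have no cycle of negative weight; an
   algorithm without this restriction is in particular one with it. *)
Definition no_negative_cycle (G : wgraph) : Prop :=
  forall s, directed_cycle G s -> (0 <= cycle_weight G s)%Z.

Definition shortest_cycle_fast (l : nat) (eps : R) : Prop :=
  forall (a b : R) (d : nat), (0 < a)%R -> (a <= b)%R ->
  solvable_in_O
    (fun G => sparse_digraph l a b d G /\ no_negative_cycle G)
    (fun G => min_solution (directed_cycle G) (cycle_weight G))
    (target_time eps).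

(* Main.v *)
(** Clique vertices are guessed around a circle of 2l+1 layers.  A vertex of layer i is
    an l-tuple (v_i, ..., v_{i+l-1}) of vertices of the n-vertex graph, and an arc to
    layer i+1 drops v_i and appends v_{i+l}, so it knows l+1 consecutive entries and can
    be charged the l edges from v_i to v_{i+1}, ..., v_{i+l}.  Any two of 2l+1 points on a
    circle are at distance at most l in exactly one direction, so a closed walk once
    around the circle pays every pair exactly once.  There are N = (2l+1) n^l vertices and
    (2l+1) n^(l+1) arcs, which is a constant times N^(1+1/l).  Non-edges are made very expensive,
    which keeps all arcs present, and a still larger constant is added to every arc, which
    makes the shortest cycles those of length 2l+1; hence one graph serves both problems.
    A fast cycle algorithm thus finds cliques in time O(n^(2l+1-l eps) + n^(2l)).

    The reduction has to be carried out by a Word-RAM program.  The program builds the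
    graph in place of the input, keeping an adjacency matrix at high addresses.  It then
    simulates the given algorithm, whose words are shorter, by masking every arithmetic
    result, and finally decodes the cycle and tests that it is a clique. *)

Require Import Defs.
From Stdlib Require Import Reals.
From Stdlib Require Import ZArith List Lia Lra.
Import ListNotations.

(** * A small imperative language on top of the Word-RAM *)

(** The cycle algorithm is promised to work only at density $\Theta(N^{1+1/l})$, however few edges
    the clique instance has. This is why non-edges must be priced instead of deleted. It is also
    promised to work only with words of exactly [word_size C N] bits, on a memory holding the
    encoding followed by zeros. Its arithmetic wraps at that length, so it cannot simply run on the
    longer words that the reduction needs for its constants and its matrix. With w' that length, the
    simulated algorithm only forms addresses below 2^w', and data placed higher is out of its reach.
    All this requires the exact value of 2^w'. The program finds the least power of two p above N by
    doubling, and then 2^w' = p^C. Its other large constants are also powers of p with exponents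
    fixed in advance, obtained by unrolled multiplications. Every k-tuple of vertices, even one with
    repetitions, closes up to a k-cycle, so the algorithm always returns some cycle. Whether a
    clique exists is decided only by the final test. A repeated vertex counts as a non-edge, so that
    test also guarantees distinct vertices. *)

Inductive expr : Set :=
  | EConst (c : nat)
  | EVar (x : nat)
  | EOp (o : binop) (a b : expr)
  | ELoad (a : expr).

Inductive stm : Set :=
  | SAssign (x : nat) (e : expr)
  | SStore (a e : expr).

(** Loops are not nested: the inner repetitions have lengths depending on [q], [C] and [D] only,
    which are constants of the program, so they are unrolled. *)
Inductive seg : Set :=
  | Block (b : list stm)
  | Loop (e : expr) (b : list stm).

Definition env : Type := ((nat -> Z) * (Z -> Z))%type.

(** [wrap] stands exactly where the compiled code ends in an instruction that reduces its result. A
    variable is copied by a bitwise OR with itself and so is reduced; a loaded word is not. *)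
Fixpoint ev (w : nat) (s : env) (e : expr) : Z :=
  match e with
  | EConst c => wrap w (Z.of_nat c)
  | EVar x => wrap w (fst s x)
  | EOp o a b => wrap w (eval_binop o (ev w s a) (ev w s b))
  | ELoad a => snd s (ev w s a)
  end.

Definition exec_stm (w : nat) (c : stm) (s : env) : env :=
  match c with
  | SAssign x e => (set_reg (fst s) x (wrap w (ev w s e)), snd s)
  | SStore a e => (fst s, set_mem (snd s) (ev w s a) (ev w s e))
  end.

Definition exec_block (w : nat) (b : list stm) (s : env) : env :=
  fold_left (fun s c => exec_stm w c s) b s.

(* Registers are split by residue modulo 3, so that the registers of the simulated
   program, the variables and the temporaries never interfere. *)
Definition sim_reg (r : nat) : nat := 3 * r.
Definition var_reg (x : nat) : nat := 3 * x + 1.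
Definition tmp_reg (j : nat) : nat := 3 * j + 2.

Fixpoint compile_expr (e : expr) (j : nat) : list instr :=
  match e with
  | EConst c => [IConst (tmp_reg j) (Z.of_nat c)]
  | EVar x => [IOp OOr (tmp_reg j) (var_reg x) (var_reg x)]
  | EOp o a b =>
      compile_expr a j ++ compile_expr b (S j) ++
      [IOp o (tmp_reg j) (tmp_reg j) (tmp_reg (S j))]
  | ELoad a => compile_expr a j ++ [ILoad (tmp_reg j) (tmp_reg j)]
  end.

Definition compile_stm (c : stm) : list instr :=
  match c with
  | SAssign x e => compile_expr e 0 ++ [IOp OOr (var_reg x) (tmp_reg 0) (tmp_reg 0)]
  | SStore a e => compile_expr a 0 ++ compile_expr e 1 ++ [IStore (tmp_reg 0) (tmp_reg 1)]
  end.

Definition compile_block (b : list stm) : list instr := flat_map compile_stm b.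

Definition loop_size (e : expr) (b : list stm) : nat :=
  length (compile_expr e 0) + length (compile_block b) + 2.

Definition compile_seg (p : nat) (g : seg) : list instr :=
  match g with
  | Block b => compile_block b
  | Loop e b =>
      compile_expr e 0 ++ [IJumpIfZero (tmp_reg 0) (p + loop_size e b)] ++
      compile_block b ++ [IJump p]
  end.

Fixpoint compile_segs (p : nat) (l : list seg) : list instr :=
  match l with
  | [] => []
  | g :: l' => compile_seg p g ++ compile_segs (p + length (compile_seg p g)) l'
  end.

(** The last index bounds the number of machine steps. A block is straight-line code and takes as
    many steps as it has instructions; the additional [loop_size] of a loop pays for the final
    failing test. *)
Inductive exec_segs (w : nat) : list seg -> env -> env -> nat -> Prop :=
  | exec_nil s : exec_segs w [] s s 0
  | exec_Block b l s s' t :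
      exec_segs w l (exec_block w b s) s' t ->
      exec_segs w (Block b :: l) s s' (length (compile_block b) + t)
  | exec_Loop e b l J s s' t :
      (forall j, j < J -> ev w (Nat.iter j (exec_block w b) s) e <> 0%Z) ->
      ev w (Nat.iter J (exec_block w b) s) e = 0%Z ->
      exec_segs w l (Nat.iter J (exec_block w b) s) s' t ->
      exec_segs w (Loop e b :: l) s s' (J * loop_size e b + loop_size e b + t).

Definition code_at (P : program) (p : nat) (c : list instr) : Prop :=
  exists pre post, P = pre ++ c ++ post /\ length pre = p.

Lemma code_at_app P p c1 c2 :
  code_at P p (c1 ++ c2) -> code_at P p c1 /\ code_at P (p + length c1) c2.
Proof.
  intros (pre & post & -> & <-); split.
  - exists pre, (c2 ++ post); now rewrite !app_assoc.
  - exists (pre ++ c1), post; rewrite length_app, !app_assoc; auto.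
Qed.

Lemma code_at_nth P p i c : code_at P p (i :: c) -> nth_error P p = Some i.
Proof.
  intros (pre & post & -> & <-).
  rewrite nth_error_app2, Nat.sub_diag by lia; reflexivity.
Qed.

Lemma run_add w P t1 t2 s : run w P (t1 + t2) s = run w P t2 (run w P t1 s).
Proof. unfold run; rewrite Nat.add_comm; apply Nat.iter_add. Qed.

Lemma run_1 w P p r m i c :
  code_at P p (i :: c) -> run w P 1 (State p r m) = exec_instr w i (State p r m).
Proof.
  intros H; unfold run; cbn [Nat.iter nat_rect]; unfold step; cbn [pc].
  now rewrite (code_at_nth _ _ _ _ H).
Qed.

Lemma set_reg_eq f r v : set_reg f r v r = v.
Proof. unfold set_reg; now rewrite Nat.eqb_refl. Qed.

Lemma set_reg_neq f r v r' : r' <> r -> set_reg f r v r' = f r'.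
Proof. unfold set_reg; intros H; apply Nat.eqb_neq in H; now rewrite H. Qed.

Lemma set_mem_eq f a v : set_mem f a v a = v.
Proof. unfold set_mem; now rewrite Z.eqb_refl. Qed.

Lemma set_mem_neq f a v a' : a' <> a -> set_mem f a v a' = f a'.
Proof. unfold set_mem; intros H; apply Z.eqb_neq in H; now rewrite H. Qed.

Definition holds_vars (r v : nat -> Z) : Prop := forall x, r (var_reg x) = v x.

(** Temporaries form a stack of depth [j]. The frame clause, that only levels from [j] on change, is
    what lets the left operand survive the evaluation of the right one. *)
Lemma compile_expr_correct w P e : forall j p r v m,
  code_at P p (compile_expr e j) -> holds_vars r v ->
  exists r',
    run w P (length (compile_expr e j)) (State p r m) =
      State (p + length (compile_expr e j)) r' m /\
    r' (tmp_reg j) = ev w (v, m) e /\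
    forall q, (forall i, j <= i -> q <> tmp_reg i) -> r' q = r q.
Proof.
  induction e as [c|x|o a IHa b IHb|a IHa]; intros j p r v m Hc Hv; cbn [compile_expr] in *.
  - eexists; split; [|split].
    + cbn [length]; rewrite (run_1 _ _ _ _ _ _ _ Hc), Nat.add_1_r; reflexivity.
    + apply set_reg_eq.
    + intros q Hq; apply set_reg_neq, Hq; lia.
  - eexists; split; [|split].
    + cbn [length]; rewrite (run_1 _ _ _ _ _ _ _ Hc), Nat.add_1_r; reflexivity.
    + rewrite set_reg_eq, Z.lor_diag; now rewrite Hv.
    + intros q Hq; apply set_reg_neq, Hq; lia.
  - apply code_at_app in Hc as [Ha Hc]; apply code_at_app in Hc as [Hb Hc].
    destruct (IHa _ _ _ _ m Ha Hv) as (r1 & E1 & V1 & F1).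
    assert (Hv1 : holds_vars r1 v)
      by (intros x; rewrite F1; [apply Hv|intros; unfold var_reg, tmp_reg; lia]).
    destruct (IHb _ _ _ _ m Hb Hv1) as (r2 & E2 & V2 & F2).
    eexists; split; [|split].
    + rewrite !length_app, !run_add, E1, E2; cbn [length].
      rewrite (run_1 _ _ _ _ _ _ _ Hc); cbn [exec_instr eval_binop]; f_equal; lia.
    + rewrite set_reg_eq, V2, F2, V1; [reflexivity|intros; unfold tmp_reg; lia].
    + intros q Hq; rewrite set_reg_neq by (apply Hq; lia).
      rewrite F2, F1; [reflexivity|auto|intros; apply Hq; lia].
  - apply code_at_app in Hc as [Ha Hc].
    destruct (IHa _ _ _ _ m Ha Hv) as (r1 & E1 & V1 & F1).
    eexists; split; [|split].
    + rewrite !length_app, !run_add, E1; cbn [length].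
      rewrite (run_1 _ _ _ _ _ _ _ Hc); cbn [exec_instr eval_binop]; f_equal; lia.
    + rewrite set_reg_eq, V1; reflexivity.
    + intros q Hq; rewrite set_reg_neq by (apply Hq; lia); auto.
Qed.

(** Kept through all compiled code, so that the simulated program starts with its registers still
    zero. *)
Definition same_sim (r r' : nat -> Z) : Prop := forall x, r' (sim_reg x) = r (sim_reg x).

Lemma compile_stm_correct w P c p r v m :
  code_at P p (compile_stm c) -> holds_vars r v ->
  exists r',
    run w P (length (compile_stm c)) (State p r m) =
      State (p + length (compile_stm c)) r' (snd (exec_stm w c (v, m))) /\
    holds_vars r' (fst (exec_stm w c (v, m))) /\ same_sim r r'.
Proof.
  destruct c as [x e|a e]; cbn [compile_stm]; intros Hc Hv.
  - apply code_at_app in Hc as [Ha Hc].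
    destruct (compile_expr_correct w _ _ _ _ _ _ m Ha Hv) as (r1 & E1 & V1 & F1).
    eexists; split; [|split].
    + rewrite !length_app, !run_add, E1; cbn [length].
      rewrite (run_1 _ _ _ _ _ _ _ Hc); cbn [exec_instr eval_binop]; f_equal; lia.
    + intros y; cbn [fst exec_stm]; rewrite Z.lor_diag, V1; unfold set_reg.
      destruct (Nat.eqb_spec y x) as [->|Hn]; [now rewrite Nat.eqb_refl|].
      destruct (Nat.eqb_spec (var_reg y) (var_reg x)) as [Hy|_];
        [unfold var_reg in Hy; lia|].
      rewrite F1; [apply Hv|intros; unfold var_reg, tmp_reg; lia].
    + intros y; rewrite set_reg_neq by (unfold sim_reg, var_reg; lia).
      apply F1; intros; unfold sim_reg, tmp_reg; lia.
  - apply code_at_app in Hc as [Ha Hc]; apply code_at_app in Hc as [Hb Hc].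
    destruct (compile_expr_correct w _ _ _ _ _ _ m Ha Hv) as (r1 & E1 & V1 & F1).
    assert (Hv1 : holds_vars r1 v)
      by (intros x; rewrite F1; [apply Hv|intros; unfold var_reg, tmp_reg; lia]).
    destruct (compile_expr_correct w _ _ _ _ _ _ m Hb Hv1) as (r2 & E2 & V2 & F2).
    exists r2; split; [|split].
    + rewrite !length_app, !run_add, E1, E2; cbn [length].
      rewrite (run_1 _ _ _ _ _ _ _ Hc); cbn [exec_instr].
      rewrite V2, F2, V1 by (intros; unfold tmp_reg; lia); f_equal; lia.
    + intros y; cbn [fst exec_stm]; rewrite F2; [apply Hv1|intros; unfold var_reg, tmp_reg; lia].
    + intros y; rewrite F2, F1; auto; intros; unfold sim_reg, tmp_reg; lia.
Qed.

Lemma compile_block_correct w P b : forall p r s,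
  code_at P p (compile_block b) -> holds_vars r (fst s) ->
  exists r',
    run w P (length (compile_block b)) (State p r (snd s)) =
      State (p + length (compile_block b)) r' (snd (exec_block w b s)) /\
    holds_vars r' (fst (exec_block w b s)) /\ same_sim r r'.
Proof.
  induction b as [|c b IH]; intros p r [v m] Hc Hv; unfold compile_block in *; cbn [flat_map fst] in *.
  - exists r; split; [|split]; [cbn; f_equal; lia|exact Hv|intros x; reflexivity].
  - apply code_at_app in Hc as [H1 H2].
    destruct (compile_stm_correct w _ _ _ _ _ m H1 Hv) as (r1 & E1 & V1 & F1).
    destruct (IH _ _ (exec_stm w c (v, m)) H2 V1) as (r2 & E2 & V2 & F2).
    exists r2; split; [|split].
    + rewrite length_app, run_add; cbn [snd]; rewrite E1, E2; f_equal; lia.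
    + exact V2.
    + intros x; now rewrite F2, F1.
Qed.

Lemma compile_loop_correct w P p e b :
  code_at P p (compile_seg p (Loop e b)) -> forall J s r,
  holds_vars r (fst s) ->
  (forall j, j < J -> ev w (Nat.iter j (exec_block w b) s) e <> 0%Z) ->
  ev w (Nat.iter J (exec_block w b) s) e = 0%Z ->
  exists t r', t <= J * loop_size e b + loop_size e b /\
    run w P t (State p r (snd s)) =
      State (p + loop_size e b) r' (snd (Nat.iter J (exec_block w b) s)) /\
    holds_vars r' (fst (Nat.iter J (exec_block w b) s)) /\ same_sim r r'.
Proof.
  intros Hc; cbn [compile_seg] in Hc.
  apply code_at_app in Hc as [He Hc]; apply code_at_app in Hc as [Hj Hc].
  apply code_at_app in Hc as [Hb Hg].
  induction J as [|J IH]; intros s r Hv H1 H2; destruct s as [v m]; cbn [fst] in Hv;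
    destruct (compile_expr_correct w _ _ _ _ _ _ m He Hv) as (r1 & E1 & V1 & F1);
    assert (Hv1 : holds_vars r1 v)
      by (intros x; rewrite F1; [apply Hv|intros; unfold var_reg, tmp_reg; lia]);
    assert (Hs1 : same_sim r r1)
      by (intros x; apply F1; intros; unfold sim_reg, tmp_reg; lia).
  - exists (length (compile_expr e 0) + 1), r1; split; [unfold loop_size; lia|].
    split; [|now split].
    rewrite run_add; cbn [snd]; rewrite E1, (run_1 _ _ _ _ _ _ _ Hj); cbn [exec_instr].
    cbn [Nat.iter nat_rect] in H2; rewrite V1, H2; reflexivity.
  - destruct (compile_block_correct w _ _ _ _ (v, m) Hb Hv1) as (r2 & E2 & V2 & F2).
    destruct (IH (exec_block w b (v, m)) r2 V2) as (t & r3 & Ht & E3 & V3 & F3).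
    + intros j Hjl; rewrite <- Nat.iter_succ_r; apply H1; lia.
    + now rewrite <- Nat.iter_succ_r.
    + rewrite <- Nat.iter_succ_r in E3, V3.
      exists (length (compile_expr e 0) + (1 + (length (compile_block b) + (1 + t)))), r3.
      split; [unfold loop_size in *; lia|]; split; [|split].
      * rewrite !run_add; cbn [snd]; rewrite E1, (run_1 _ _ _ _ _ _ _ Hj).
        cbn [exec_instr length].
        rewrite V1, (proj2 (Z.eqb_neq _ _)) by exact (H1 0 ltac:(lia)).
        cbn [length] in E2; rewrite Nat.add_1_r in E2; cbn [snd] in E2; rewrite E2.
        cbn [length] in Hg; rewrite Nat.add_1_r in Hg.
        rewrite (run_1 _ _ _ _ _ _ _ Hg); cbn [exec_instr].
        rewrite E3; reflexivity.
      * exact V3.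
      * intros x; now rewrite F3, F2, Hs1.
Qed.

Lemma length_compile_loop p e b : length (compile_seg p (Loop e b)) = loop_size e b.
Proof. cbn [compile_seg]; rewrite !length_app; cbn [length]; unfold loop_size; lia. Qed.

Lemma compile_segs_correct w P l s s' T :
  exec_segs w l s s' T -> forall p r,
  code_at P p (compile_segs p l) -> holds_vars r (fst s) ->
  exists t r', t <= T /\
    run w P t (State p r (snd s)) =
      State (p + length (compile_segs p l)) r' (snd s') /\
    holds_vars r' (fst s') /\ same_sim r r'.
Proof.
  induction 1 as [s|b l s s' T _ IH|e b l J s s' T H1 H2 _ IH]; intros p r Hc Hv;
    cbn [compile_segs] in Hc |- *.
  - exists 0, r; split; [lia|]; split; [cbn; f_equal; lia|].
    split; [exact Hv|intros x; reflexivity].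
  - apply code_at_app in Hc as [Ha Hc].
    destruct (compile_block_correct w _ _ _ _ _ Ha Hv) as (r1 & E1 & V1 & F1).
    destruct (IH _ _ Hc V1) as (t & r2 & Ht & E2 & V2 & F2).
    exists (length (compile_block b) + t), r2; split; [lia|]; split; [|split].
    + rewrite run_add, E1; cbn [compile_seg] in E2 |- *; rewrite E2, length_app; f_equal; lia.
    + exact V2.
    + intros x; now rewrite F2, F1.
  - apply code_at_app in Hc as [Ha Hc].
    destruct (compile_loop_correct w _ _ _ _ Ha _ _ _ Hv H1 H2) as (t1 & r1 & Ht1 & E1 & V1 & F1).
    rewrite length_compile_loop in Hc.
    destruct (IH _ _ Hc V1) as (t & r2 & Ht & E2 & V2 & F2).
    exists (t1 + t), r2; split; [lia|]; split; [|split].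
    + rewrite run_add, E1, E2, length_app, length_compile_loop; f_equal; lia.
    + exact V2.
    + intros x; now rewrite F2, F1.
Qed.

(** * Simulation of a machine with shorter words *)

(** Every instruction becomes exactly two, padded by a jump to the next pair, so that target [q]
    becomes [base + 2 * q]. Targets outside the program are capped at [len]: all ways of halting
    lead to the first instruction after the translated code. *)
Definition translate_instr (base len mask p : nat) (i : instr) : list instr :=
  match i with
  | IConst d c => [IConst (sim_reg d) c; IOp OAnd (sim_reg d) (sim_reg d) mask]
  | IOp o d a b =>
      [IOp o (sim_reg d) (sim_reg a) (sim_reg b); IOp OAnd (sim_reg d) (sim_reg d) mask]
  | ILoad d a => [ILoad (sim_reg d) (sim_reg a); IJump (base + 2 * S p)]
  | IStore a r => [IStore (sim_reg a) (sim_reg r); IJump (base + 2 * S p)]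
  | IJump q => [IJump (base + 2 * Nat.min q len); IJump (base + 2 * S p)]
  | IJumpIfZero r q =>
      [IJumpIfZero (sim_reg r) (base + 2 * Nat.min q len); IJump (base + 2 * S p)]
  end.

Fixpoint translate_from (base len mask p : nat) (P : program) : list instr :=
  match P with
  | [] => []
  | i :: P' => translate_instr base len mask p i ++ translate_from base len mask (S p) P'
  end.

Definition translate (base mask : nat) (P : program) : list instr :=
  translate_from base (length P) mask 0 P.

Lemma length_translate_from base len mask P : forall p,
  length (translate_from base len mask p P) = 2 * length P.
Proof.
  induction P as [|i P IH]; intros p; cbn [translate_from length]; [reflexivity|].
  rewrite length_app, IH; destruct i; cbn [length translate_instr]; lia.
Qed.

Lemma code_at_translate_from base len mask Q P : forall p i q,
  code_at Q (base + 2 * p) (translate_from base len mask p P) ->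
  nth_error P q = Some i ->
  code_at Q (base + 2 * (p + q)) (translate_instr base len mask (p + q) i).
Proof.
  induction P as [|j P IH]; intros p i q Hc Hn; [destruct q; discriminate|].
  cbn [translate_from] in Hc; apply code_at_app in Hc as [H1 H2].
  destruct q as [|q]; cbn in Hn.
  - injection Hn as ->; now rewrite Nat.add_0_r.
  - replace (p + S q) with (S p + q) by lia; apply IH; [|exact Hn].
    replace (length (translate_instr base len mask p j)) with 2 in H2
      by (destruct j; reflexivity).
    now replace (base + 2 * S p) with (base + 2 * p + 2) by lia.
Qed.

Lemma pow2_pos w : (0 < 2 ^ Z.of_nat w)%Z.
Proof. apply Z.pow_pos_nonneg; lia. Qed.

Lemma wrap_range w z : (0 <= wrap w z < 2 ^ Z.of_nat w)%Z.
Proof. apply Z.mod_pos_bound, pow2_pos. Qed.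

Lemma wrap_small w z : (0 <= z < 2 ^ Z.of_nat w)%Z -> wrap w z = z.
Proof. apply Z.mod_small. Qed.

Lemma wrap_wrap w w' z : w' <= w -> wrap w' (wrap w z) = wrap w' z.
Proof.
  intros H; apply Z.mod_mod_divide.
  exists (2 ^ Z.of_nat (w - w'))%Z; rewrite <- Z.pow_add_r by lia; f_equal; lia.
Qed.

(** Since 2^w' divides 2^w, reducing modulo 2^w first loses nothing modulo 2^w'. One AND after each
    operation therefore reproduces the short-word result, including two's complement values. *)
Lemma wrap_land_mask w w' z : w' <= w ->
  wrap w (Z.land (wrap w z) (2 ^ Z.of_nat w' - 1)) = wrap w' z.
Proof.
  intros H; rewrite <- (wrap_wrap w w' z H).
  replace (2 ^ Z.of_nat w' - 1)%Z with (Z.ones (Z.of_nat w'))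
    by (rewrite Z.ones_equiv; lia).
  rewrite Z.land_ones by lia; apply wrap_small.
  pose proof (wrap_range w' (wrap w z)) as R; unfold wrap at 1 in R; unfold wrap at 1 3.
  split; [lia|]; eapply Z.lt_le_trans; [apply R|apply Z.pow_le_mono_r; lia].
Qed.

(** Memories agree only on addresses below 2^w'. The range clauses keep every register, hence every
    address used, in that region; everything above stays as in [m0]. *)
Record simulated (w' base len : nat) (m0 : Z -> Z) (s sQ : state) : Prop := {
  sim_pc : pc sQ = base + 2 * Nat.min (pc s) len;
  sim_regs : forall x, regs sQ (sim_reg x) = regs s x;
  sim_regs_range : forall x, (0 <= regs s x < 2 ^ Z.of_nat w')%Z;
  sim_mem : forall a, (0 <= a < 2 ^ Z.of_nat w')%Z -> mem sQ a = mem s a;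
  sim_mem_range : forall a, (0 <= a < 2 ^ Z.of_nat w')%Z ->
    (0 <= mem s a < 2 ^ Z.of_nat w')%Z;
  sim_mem_high : forall a, (2 ^ Z.of_nat w' <= a)%Z -> mem sQ a = m0 a }.

Definition same_vars (r r' : nat -> Z) : Prop := forall x, r' (var_reg x) = r (var_reg x).

Lemma simulate_step w w' P Q base x m0 s sQ :
  w' <= w ->
  code_at Q base (translate base (var_reg x) P) ->
  regs sQ (var_reg x) = (2 ^ Z.of_nat w' - 1)%Z ->
  simulated w' base (length P) m0 s sQ ->
  exists t, t <= 2 /\ same_vars (regs sQ) (regs (run w Q t sQ)) /\
    simulated w' base (length P) m0 (step w' P s) (run w Q t sQ).
Proof.
  intros Hw Hc Hm [S1 S2 S3 S4 S5 S6].
  unfold step; destruct (nth_error P (pc s)) as [i|] eqn:En.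
  2:{ exists 0; split; [lia|]; split; [intros y; reflexivity|]; now constructor. }
  assert (Hlt : pc s < length P) by (apply nth_error_Some; congruence).
  replace base with (base + 2 * 0) in Hc at 1 by lia.
  pose proof (code_at_translate_from _ _ _ _ _ _ _ _ Hc En) as Hi.
  destruct s as [p r m], sQ as [pQ rQ mQ]; cbn [pc regs mem Nat.add] in *.
  rewrite Nat.min_l in S1 by lia; subst pQ.
  assert (Hrange : forall d z y, (0 <= set_reg r d (wrap w' z) y < 2 ^ Z.of_nat w')%Z).
  { intros d z y; unfold set_reg; destruct (y =? d); [apply wrap_range|apply S3]. }
  assert (Hand : forall d z y,
    set_reg (set_reg rQ (sim_reg d) (wrap w z)) (sim_reg d)
      (wrap w (Z.land (wrap w z) (2 ^ Z.of_nat w' - 1))) (sim_reg y) =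
    set_reg r d (wrap w' z) y).
  { intros d z y; rewrite wrap_land_mask by exact Hw; unfold set_reg.
    destruct (Nat.eqb_spec y d) as [->|Hn]; [now rewrite Nat.eqb_refl|].
    destruct (Nat.eqb_spec (sim_reg y) (sim_reg d)) as [E|_]; [unfold sim_reg in E; lia|].
    apply S2. }
  assert (Hvar : forall d z y, set_reg rQ (sim_reg d) z (var_reg y) = rQ (var_reg y))
    by (intros; apply set_reg_neq; unfold sim_reg, var_reg; lia).
  assert (H1 : forall i1 i2, code_at Q (base + 2 * p) [i1; i2] ->
    code_at Q (S (base + 2 * p)) [i2]).
  { intros i1 i2 H; apply (code_at_app _ _ [i1] [i2]) in H as [_ H].
    cbn [length] in H; now rewrite Nat.add_1_r in H. }
  assert (Hp : S (S (base + 2 * p)) = base + 2 * Nat.min (S p) (length P)) by lia.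
  destruct i as [d c|o d a b|d a|a b|q|b q]; cbn [translate_instr exec_instr] in *.
  - exists (1 + 1); split; [lia|].
    rewrite run_add, (run_1 _ _ _ _ _ _ _ Hi); cbn [exec_instr].
    rewrite (run_1 _ _ _ _ _ _ _ (H1 _ _ Hi)); cbn [exec_instr eval_binop regs].
    rewrite set_reg_eq, Hvar, Hm; split.
    + intros y; rewrite set_reg_neq by (unfold sim_reg, var_reg; lia); apply Hvar.
    + constructor; cbn [pc regs mem]; auto.
  - exists (1 + 1); split; [lia|].
    rewrite run_add, (run_1 _ _ _ _ _ _ _ Hi); cbn [exec_instr].
    rewrite (run_1 _ _ _ _ _ _ _ (H1 _ _ Hi)); cbn [exec_instr regs].
    rewrite set_reg_eq, Hvar, Hm, !S2; cbn [eval_binop]; split.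
    + intros y; rewrite set_reg_neq by (unfold sim_reg, var_reg; lia); apply Hvar.
    + constructor; cbn [pc regs mem]; auto.
  - exists (1 + 1); split; [lia|].
    rewrite run_add, (run_1 _ _ _ _ _ _ _ Hi); cbn [exec_instr].
    rewrite (run_1 _ _ _ _ _ _ _ (H1 _ _ Hi)); cbn [exec_instr regs].
    rewrite S2, S4 by apply S3; split; [intros y; apply Hvar|].
    constructor; cbn [pc regs mem]; auto; [lia| |].
    + intros y; unfold set_reg.
      destruct (Nat.eqb_spec y d) as [->|Hn]; [now rewrite Nat.eqb_refl|].
      destruct (Nat.eqb_spec (sim_reg y) (sim_reg d)) as [E|_]; [unfold sim_reg in E; lia|].
      apply S2.
    + intros y; unfold set_reg; destruct (y =? d); auto.
  - exists (1 + 1); split; [lia|].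
    rewrite run_add, (run_1 _ _ _ _ _ _ _ Hi); cbn [exec_instr].
    rewrite (run_1 _ _ _ _ _ _ _ (H1 _ _ Hi)); cbn [exec_instr regs].
    rewrite !S2; split; [intros y; reflexivity|].
    constructor; cbn [pc regs mem]; auto; [lia| | |].
    + intros y Hy; unfold set_mem; destruct (y =? r a)%Z; auto.
    + intros y Hy; unfold set_mem; destruct (y =? r a)%Z; auto.
    + intros y Hy; rewrite set_mem_neq; auto; specialize (S3 a); lia.
  - exists 1; split; [lia|].
    rewrite (run_1 _ _ _ _ _ _ _ Hi); cbn [exec_instr regs].
    split; [intros y; reflexivity|]; constructor; cbn [pc regs mem]; auto.
  - destruct (r b =? 0)%Z eqn:Eb.
    + exists 1; split; [lia|].
      rewrite (run_1 _ _ _ _ _ _ _ Hi); cbn [exec_instr regs]; rewrite S2, Eb.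
      split; [intros y; reflexivity|]; constructor; cbn [pc regs mem]; auto.
    + exists (1 + 1); split; [lia|].
      rewrite run_add, (run_1 _ _ _ _ _ _ _ Hi); cbn [exec_instr]; rewrite S2, Eb.
      rewrite (run_1 _ _ _ _ _ _ _ (H1 _ _ Hi)); cbn [exec_instr regs].
      split; [intros y; reflexivity|]; constructor; cbn [pc regs mem]; auto; lia.
Qed.

Lemma simulate_run w w' P Q base x m0 s sQ T :
  w' <= w ->
  code_at Q base (translate base (var_reg x) P) ->
  regs sQ (var_reg x) = (2 ^ Z.of_nat w' - 1)%Z ->
  simulated w' base (length P) m0 s sQ ->
  exists t, t <= 2 * T /\ same_vars (regs sQ) (regs (run w Q t sQ)) /\
    simulated w' base (length P) m0 (run w' P T s) (run w Q t sQ).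
Proof.
  intros Hw Hc Hm Hs; induction T as [|T (t & Ht & Hv & Hs')].
  - exists 0; split; [lia|]; split; [intros y; reflexivity|exact Hs].
  - rewrite <- (Hv x) in Hm.
    destruct (simulate_step w w' P Q base x m0 _ _ Hw Hc Hm Hs') as (t' & Ht' & Hv' & Hs'').
    exists (t + t'); split; [lia|]; rewrite run_add; split; [|exact Hs''].
    intros y; now rewrite Hv', Hv.
Qed.

(** * Finite sums *)

Fixpoint sum_n (L : nat) (f : nat -> nat) : nat :=
  match L with
  | 0 => 0
  | S L' => sum_n L' f + f L'
  end.

Lemma sum_n_ext L f g : (forall i, i < L -> f i = g i) -> sum_n L f = sum_n L g.
Proof.
  induction L as [|L IH]; intros H; cbn; [reflexivity|].
  rewrite IH, H; auto.
Qed.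

Lemma sum_n_le L f c : (forall i, i < L -> f i <= c) -> sum_n L f <= L * c.
Proof.
  induction L as [|L IH]; intros H; cbn; [lia|].
  specialize (IH (fun i Hi => H i (Nat.lt_lt_succ_r _ _ Hi))).
  specialize (H L (Nat.lt_succ_diag_r L)); lia.
Qed.

Lemma sum_n_ge L f c : (forall i, i < L -> c <= f i) -> L * c <= sum_n L f.
Proof.
  induction L as [|L IH]; intros H; cbn; [lia|].
  specialize (IH (fun i Hi => H i (Nat.lt_lt_succ_r _ _ Hi))).
  specialize (H L (Nat.lt_succ_diag_r L)); lia.
Qed.

Lemma sum_n_const L c : sum_n L (fun _ => c) = L * c.
Proof. induction L; cbn; lia. Qed.

Lemma sum_n_plus L f g : sum_n L (fun i => f i + g i) = sum_n L f + sum_n L g.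
Proof. induction L; cbn; lia. Qed.

Lemma sum_n_mul_l L c f : sum_n L (fun i => c * f i) = c * sum_n L f.
Proof. induction L; cbn; lia. Qed.

Lemma sum_n_swap L K f :
  sum_n L (fun i => sum_n K (fun j => f i j)) = sum_n K (fun j => sum_n L (fun i => f i j)).
Proof.
  induction L as [|L IH]; cbn.
  - induction K; cbn; lia.
  - rewrite IH, <- sum_n_plus; reflexivity.
Qed.

Lemma sum_n_app L K f : sum_n (L + K) f = sum_n L f + sum_n K (fun i => f (L + i)).
Proof.
  induction K as [|K IH]; cbn; [now rewrite !Nat.add_0_r|].
  rewrite Nat.add_succ_r; cbn; lia.
Qed.

Lemma sum_n_first L f : sum_n (S L) f = f 0 + sum_n L (fun i => f (S i)).
Proof. apply (sum_n_app 1 L). Qed.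

Lemma sum_n_rev L f : sum_n L (fun i => f (L - i)) = sum_n L (fun i => f (S i)).
Proof.
  induction L as [|L IH]; [reflexivity|].
  rewrite sum_n_first; cbn [sum_n].
  rewrite (sum_n_ext L (fun i => f (S L - S i)) (fun i => f (L - i))) by reflexivity.
  rewrite IH, Nat.sub_0_r; lia.
Qed.

Lemma sum_n_shift L f a :
  (forall i, f (i + L) = f i) -> sum_n L (fun i => f (i + a)) = sum_n L f.
Proof.
  intros Hf; induction a as [|a IH].
  - apply sum_n_ext; intros; f_equal; lia.
  - rewrite <- IH; destruct L as [|L]; [reflexivity|].
    rewrite (sum_n_first L (fun i => f (i + a))); cbn [sum_n].
    replace (f (L + S a)) with (f (0 + a)).
    + rewrite Nat.add_comm; f_equal; apply sum_n_ext; intros; f_equal; lia.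
    + rewrite <- (Hf (0 + a)); f_equal; lia.
Qed.

(** * Sums over unordered pairs and the circle of 2l+1 points *)

Fixpoint pair_sum (c : nat -> nat -> nat) (s : list nat) : nat :=
  match s with
  | [] => 0
  | v :: s' => list_sum (map (c v) s') + pair_sum c s'
  end.

Lemma list_sum_plus (f g : nat -> nat) s :
  list_sum (map (fun x => f x + g x) s) = list_sum (map f s) + list_sum (map g s).
Proof. unfold list_sum; induction s; cbn; lia. Qed.

(** The diagonal is kept on both sides because a vertex paired with itself is priced like a
    non-edge, so [c x x] is not zero in the application. *)
Lemma double_pair_sum c s :
  (forall u v, c u v = c v u) ->
  2 * pair_sum c s + list_sum (map (fun x => c x x) s) =
  list_sum (map (fun x => list_sum (map (c x) s)) s).
Proof.
  intros Hc; induction s as [|v s IH]; [reflexivity|].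
  assert (E : list_sum (map (fun x => list_sum (map (c x) (v :: s))) s) =
    list_sum (map (c v) s) + list_sum (map (fun x => list_sum (map (c x) s)) s)).
  { rewrite <- list_sum_plus; f_equal; apply map_ext; intros x; cbn; now rewrite (Hc x v). }
  change (2 * (list_sum (map (c v) s) + pair_sum c s) +
    (c v v + list_sum (map (fun x => c x x) s)) =
    c v v + list_sum (map (c v) s) +
    list_sum (map (fun x => list_sum (map (c x) (v :: s))) s)).
  rewrite E; lia.
Qed.

Lemma list_sum_seq f L : list_sum (map f (seq 0 L)) = sum_n L f.
Proof.
  induction L as [|L IH]; [reflexivity|].
  rewrite seq_S, map_app, list_sum_app, IH; cbn; lia.
Qed.

(* On a circle of 2l+1 points every unordered pair is joined by exactly one arc of
   length at most l. *)
Lemma cyclic_pair_sum c g l :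
  (forall u v, c u v = c v u) ->
  (forall i, g (i + (2 * l + 1)) = g i) ->
  sum_n (2 * l + 1) (fun j => sum_n l (fun t => c (g j) (g (j + S t)))) =
  pair_sum c (map g (seq 0 (2 * l + 1))).
Proof.
  intros Hc Hg; set (k := 2 * l + 1) in *.
  set (A := sum_n k _).
  pose proof (double_pair_sum c (map g (seq 0 k)) Hc) as D.
  rewrite !map_map in D; rewrite !list_sum_seq in D.
  rewrite (sum_n_ext k (fun x => list_sum (map (c (g x)) (map g (seq 0 k))))
    (fun x => c (g x) (g x) + (sum_n l (fun t => c (g x) (g (x + S t))) +
       sum_n l (fun t => c (g x) (g (x + (S l + t))))))) in D.
  - rewrite !sum_n_plus in D; fold A in D.
    (* Row x of the full double sum is split into the diagonal, the distances 1 to l, and the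
       distances l+1 to 2l. It remains to see that the two halves have the same total. *)
    enough (E : sum_n k (fun i => sum_n l (fun t => c (g i) (g (i + (S l + t))))) = A) by lia.
    unfold A; rewrite (sum_n_swap k l (fun j t => c (g j) (g (j + S t)))).
    rewrite (sum_n_swap k l (fun j t => c (g j) (g (j + (S l + t))))).
    rewrite <- (sum_n_rev l (fun t => sum_n k (fun j => c (g j) (g (j + t))))).
    apply sum_n_ext; intros t Ht.
    (* Distance l+1+t in one direction is distance l-t in the other: after moving the start by l-t,
       the end point is i+k, which is i again. *)
    rewrite <- (sum_n_shift k (fun i => c (g i) (g (i + (S l + t)))) (l - t)).
    + apply sum_n_ext; intros i _.
      replace (i + (l - t) + (S l + t)) with (i + k) by lia.
      now rewrite Hg, Hc.
    + intros i; rewrite Hg.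
      now replace (i + k + (S l + t)) with (i + (S l + t) + k) by lia; rewrite Hg.
  - intros x _; rewrite map_map, list_sum_seq.
    rewrite <- (sum_n_shift k (fun i => c (g x) (g i)) x) by (intros; now rewrite Hg).
    replace k with (1 + (l + l)) by lia; rewrite !sum_n_app; cbn [sum_n].
    f_equal; f_equal; apply sum_n_ext; intros i _; do 2 f_equal; lia.
Qed.

(** * Digits *)

Definition digit (n i x : nat) : nat := (x / n ^ i) mod n.

Definition from_digits (n l : nat) (d : nat -> nat) : nat := sum_n l (fun i => d i * n ^ i).

Lemma from_digits_lt n l d : (forall i, d i < n) -> from_digits n l d < n ^ l.
Proof.
  intros Hd; induction l as [|l IH]; [cbn; lia|].
  change (from_digits n (S l) d) with (from_digits n l d + d l * n ^ l).
  rewrite Nat.pow_succ_r'; specialize (Hd l); nia.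
Qed.

Lemma from_digits_first n l d :
  from_digits n (S l) d = d 0 + n * from_digits n l (fun i => d (S i)).
Proof.
  unfold from_digits; rewrite sum_n_first, <- sum_n_mul_l; cbn [Nat.pow].
  f_equal; [lia|]; apply sum_n_ext; intros; lia.
Qed.

Lemma div_mod_add q b r : r < b -> (q * b + r) / b = q /\ (q * b + r) mod b = r.
Proof.
  intros H; split.
  - symmetry; apply (Nat.div_unique _ _ _ r); lia.
  - symmetry; apply (Nat.mod_unique _ _ q); lia.
Qed.

Lemma digit_mod_pow n i l x : 1 <= n -> i < l -> digit n i (x mod n ^ l) = digit n i x.
Proof.
  intros Hn Hi; unfold digit.
  replace l with (i + S (l - S i)) by lia.
  rewrite Nat.pow_add_r, Nat.Div0.mod_mul_r, (Nat.mul_comm (n ^ i)), Nat.add_comm.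
  pose proof (Nat.pow_nonzero n i ltac:(lia)) as Hp.
  rewrite (proj1 (div_mod_add _ _ _ (Nat.mod_upper_bound x (n ^ i) Hp))).
  rewrite Nat.pow_succ_r', Nat.Div0.mod_mul_r.
  rewrite (Nat.mul_comm n), Nat.Div0.mod_add, Nat.Div0.mod_mod; reflexivity.
Qed.

(** * Cycles of a weighted digraph *)

Lemma nth_map_seq (A : Type) (f : nat -> A) L i d :
  i < L -> nth i (map f (seq 0 L)) d = f i.
Proof.
  intros Hi; rewrite (nth_indep _ d (f 0)) by (now rewrite length_map, length_seq).
  now rewrite map_nth, seq_nth.
Qed.

(** Indexing modulo the length turns a cycle into a periodic sequence, in which the closing arc is
    no special case. *)
Lemma cycle_arcs_seq s :
  cycle_arcs s = map (fun j => (nth (j mod length s) s 0, nth (S j mod length s) s 0))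
                     (seq 0 (length s)).
Proof.
  destruct s as [|a s]; [reflexivity|].
  unfold cycle_arcs; cbn [tl firstn].
  assert (HL : length (a :: s) = length (s ++ [a])) by (rewrite length_app; cbn; lia).
  apply (nth_ext _ _ (0, 0) (0, 0)).
  - rewrite length_combine, length_map, length_seq, <- HL; lia.
  - intros j Hj; rewrite length_combine, <- HL, Nat.min_id in Hj.
    rewrite combine_nth by exact HL.
    rewrite nth_map_seq by exact Hj.
    rewrite (Nat.mod_small j) by exact Hj; f_equal.
    destruct (Nat.eq_dec (S j) (length (a :: s))) as [E|E].
    + rewrite E, Nat.Div0.mod_same; cbn in E.
      rewrite app_nth2 by lia; replace (j - length s) with 0 by lia; reflexivity.
    + rewrite Nat.mod_small by lia; cbn in *; apply app_nth1; lia.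
Qed.

Lemma sumZ_seq g f L :
  (forall j, j < L -> g j = Z.of_nat (f j)) -> sumZ (map g (seq 0 L)) = Z.of_nat (sum_n L f).
Proof.
  intros H.
  enough (E : forall a K, a + K = L ->
    sumZ (map g (seq a K)) = Z.of_nat (sum_n K (fun i => f (a + i)))) by exact (E 0 L eq_refl).
  intros a K; revert a; induction K as [|K IH]; intros a Ha; [reflexivity|].
  rewrite sum_n_first; cbn [seq map]; change (sumZ (?x :: ?y)) with (x + sumZ y)%Z.
  rewrite IH, H, Nat2Z.inj_add, Nat.add_0_r by lia; f_equal; f_equal.
  apply sum_n_ext; intros; f_equal; lia.
Qed.

Lemma arc_weight_of_fun G g u v :
  (forall a b x, In (a, b, x) (edges G) -> x = g a b) -> arc G u v ->
  arc_weight G u v = g u v.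
Proof.
  intros Hg Ha; unfold arc_weight.
  destruct (find _ _) as [[[a b] x]|] eqn:E.
  - apply find_some in E as [Hi E]; cbn in E |- *.
    apply andb_prop in E as [E1 E2]; apply Nat.eqb_eq in E1, E2; subst; auto.
  - apply in_map_iff in Ha as ([[a b] x] & Hab & Hi); cbn in Hab; injection Hab as -> ->.
    pose proof (find_none _ _ E _ Hi) as Hf; cbn in Hf; now rewrite !Nat.eqb_refl in Hf.
Qed.

(** * The layered graph *)

Section Layered.

(* [q] is l - 1.  A vertex [i * n ^ S q + x] is the l-tuple of base-n digits of [x],
   most significant first, in layer [i] out of 2l+1; arc number [e] encodes a layer
   together with l+1 digits. *)
Variables (n q shift : nat) (cost : nat -> nat -> nat).
Hypothesis Hn : 1 <= n.
Hypothesis cost_sym : forall u v, cost u v = cost v u.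

Let k := 2 * S q + 1.
Let B := n ^ S q.

(** The first entry of the tuple of [u], which the arcs out of [u] drop and whose l edges they pay
    for. *)
Definition top (u : nat) : nat := (u mod n ^ S q) / n ^ q.

(** The l+1 digits of [z] are read as a window: the source keeps the first l of them ([z / n]), the
    target the last l ([z mod n ^ S q]). *)
Definition larc (e : nat) : nat * nat :=
  let i := e / n ^ S (S q) in
  let z := e mod n ^ S (S q) in
  (i * n ^ S q + z / n, (S i mod (2 * S q + 1)) * n ^ S q + z mod n ^ S q).

Definition lweight (u v : nat) : nat :=
  shift + sum_n (S q) (fun i => cost (top u) (digit n i (v mod n ^ S q))).

Definition layered : wgraph :=
  WGraph ((2 * S q + 1) * n ^ S q)
    (map (fun e => (larc e, Z.of_nat (lweight (fst (larc e)) (snd (larc e)))))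
         (seq 0 ((2 * S q + 1) * n ^ S (S q)))).

(** Consecutive layers and overlapping tuples: all digits of [v] but the last are all digits of [u]
    but the first. *)
Definition ladj (u v : nat) : Prop :=
  u < k * B /\ v < k * B /\ v / B = S (u / B) mod k /\ (v mod B) / n = (u mod B) mod n ^ q.

Definition larc_inv (p : nat * nat) : nat :=
  (fst p / B) * n ^ S (S q) + ((fst p mod B) * n + (snd p mod B) mod n).

Lemma B_pos : 0 < B.
Proof. unfold B; pose proof (Nat.pow_nonzero n (S q)); lia. Qed.

Lemma B_eq : B = n * n ^ q.
Proof. apply Nat.pow_succ_r'. Qed.

Lemma nn_eq : n ^ S (S q) = B * n.
Proof. unfold B; rewrite (Nat.pow_succ_r' n (S q)); lia. Qed.

Lemma larc_parts e : e < k * (B * n) ->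
  let z := e mod (B * n) in
  fst (larc e) / B = e / (B * n) /\ fst (larc e) mod B = z / n /\
  snd (larc e) / B = S (e / (B * n)) mod k /\ snd (larc e) mod B = z mod B /\
  e / (B * n) < k /\ z / n < B.
Proof.
  intros He z; unfold larc; cbn [fst snd]; rewrite nn_eq; fold B k z.
  pose proof B_pos as HB.
  assert (Hz : z < B * n) by (apply Nat.mod_upper_bound; nia).
  assert (Hz' : z / n < B) by (apply Nat.Div0.div_lt_upper_bound; lia).
  destruct (div_mod_add (e / (B * n)) B (z / n) Hz') as [-> ->].
  destruct (div_mod_add (S (e / (B * n)) mod k) B (z mod B)) as [-> ->];
    [apply Nat.mod_upper_bound; lia|].
  repeat split; auto; apply Nat.Div0.div_lt_upper_bound; lia.
Qed.

Lemma larc_inv_larc e : e < (2 * S q + 1) * n ^ S (S q) -> larc_inv (larc e) = e.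
Proof.
  rewrite nn_eq; intros He.
  destruct (larc_parts e He) as (E1 & E2 & _ & E4 & _).
  unfold larc_inv; rewrite E1, E2, E4, nn_eq.
  set (z := e mod (B * n)).
  replace (z mod B mod n) with (z mod n).
  - pose proof (Nat.div_mod_eq z n); pose proof (Nat.div_mod_eq e (B * n)); fold z in H0; lia.
  - rewrite B_eq, Nat.Div0.mod_mul_r, (Nat.mul_comm n (_ mod _)).
    now rewrite Nat.Div0.mod_add, Nat.Div0.mod_mod.
Qed.

Lemma larc_ladj e : e < (2 * S q + 1) * n ^ S (S q) -> ladj (fst (larc e)) (snd (larc e)).
Proof.
  rewrite nn_eq; intros He.
  destruct (larc_parts e He) as (E1 & E2 & E3 & E4 & E5 & E6).
  pose proof B_pos as HB; unfold ladj; rewrite E1, E2, E3, E4; repeat split.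
  - pose proof (Nat.div_mod_eq (fst (larc e)) B); nia.
  - pose proof (Nat.div_mod_eq (snd (larc e)) B).
    pose proof (Nat.mod_upper_bound (S (e / (B * n))) k ltac:(lia)).
    pose proof (Nat.mod_upper_bound (snd (larc e)) B ltac:(lia)); nia.
  - rewrite B_eq at 2; rewrite Nat.Div0.mod_mul_r, Nat.add_comm, Nat.mul_comm.
    apply div_mod_add, Nat.mod_upper_bound; lia.
Qed.

Lemma ladj_larc u v : ladj u v ->
  larc (larc_inv (u, v)) = (u, v) /\ larc_inv (u, v) < (2 * S q + 1) * n ^ S (S q).
Proof.
  intros (Hu & Hv & HL & HD); unfold larc_inv, larc; cbn [fst snd].
  pose proof B_pos as HB; rewrite nn_eq; fold B k.
  pose proof (Nat.mod_upper_bound u B ltac:(lia)) as HuB.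
  pose proof (Nat.mod_upper_bound (v mod B) n ltac:(lia)) as Hvn.
  set (z := (u mod B) * n + (v mod B) mod n).
  assert (Hz : z < B * n) by (unfold z; nia).
  destruct (div_mod_add (u / B) (B * n) z Hz) as [-> ->].
  destruct (div_mod_add (u mod B) n _ Hvn) as [E1 E2]; fold z in E1, E2.
  rewrite E1; rewrite B_eq at 6; rewrite Nat.Div0.mod_mul_r, E1, E2, <- HD, <- HL; split.
  - pose proof (Nat.div_mod_eq u B); pose proof (Nat.div_mod_eq v B).
    pose proof (Nat.div_mod_eq (v mod B) n); f_equal; lia.
  - assert (u / B < k) by (apply Nat.Div0.div_lt_upper_bound; lia); nia.
Qed.

Lemma arc_layered u v : arc layered u v <-> ladj u v.
Proof.
  unfold arc, layered; cbn [edges]; rewrite map_map; cbn [fst].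
  rewrite in_map_iff; split.
  - intros (e & He & Hi); apply in_seq in Hi.
    pose proof (larc_ladj e ltac:(lia)) as H; now rewrite He in H.
  - intros H; apply ladj_larc in H as [H1 H2].
    exists (larc_inv (u, v)); split; [exact H1|]; apply in_seq; lia.
Qed.

Lemma layered_edge u v x : In (u, v, x) (edges layered) ->
  ladj u v /\ x = Z.of_nat (lweight u v).
Proof.
  intros H; split.
  - apply arc_layered, in_map_iff; exists (u, v, x); auto.
  - cbn [edges layered] in H; apply in_map_iff in H as (e & He & _).
    pose proof (f_equal fst He) as H1; pose proof (f_equal snd He) as H2.
    cbn [fst snd] in H1, H2; now rewrite <- H2, H1.
Qed.

Lemma arc_weight_layered u v : ladj u v -> arc_weight layered u v = Z.of_nat (lweight u v).
Proof.
  intros H; apply (arc_weight_of_fun layered (fun a b => Z.of_nat (lweight a b))).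
  - intros a b x Hi; now apply layered_edge.
  - now apply arc_layered.
Qed.

(** An arc changes the layer by one modulo k >= 3, so it is no loop; arc numbers are recovered by
    [larc_inv], so no arc is listed twice. *)
Lemma is_digraph_layered : is_digraph layered.
Proof.
  split.
  - intros u v x Hi; apply layered_edge in Hi as [(Hu & Hv & HL & _) _].
    repeat split; [exact Hu|exact Hv|intros <-].
    assert (Hi : u / B < k) by (apply Nat.Div0.div_lt_upper_bound; pose proof B_pos; nia).
    destruct (Nat.eq_dec (S (u / B)) k) as [E|E].
    + rewrite E, Nat.Div0.mod_same in HL; unfold k in *; lia.
    + rewrite Nat.mod_small in HL; lia.
  - cbn [edges layered]; rewrite map_map; cbn [fst].
    apply NoDup_map_NoDup_ForallPairs; [|apply seq_NoDup].
    intros a b Ha Hb E; apply in_seq in Ha, Hb.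
    rewrite <- (larc_inv_larc a), <- (larc_inv_larc b) by lia; now rewrite E.
Qed.

(** * Cycles of the layered graph and the tuples they carry *)

Section Cycle.

Variable s : list nat.
Hypothesis Hs : directed_cycle layered s.

Let L := length s.
Let c (j : nat) : nat := nth (j mod L) s 0.

Lemma L_pos : 0 < L.
Proof. destruct Hs as [H _]; unfold L; destruct s; [congruence|cbn; lia]. Qed.

Lemma c_period j : c (j + L) = c j.
Proof.
  unfold c; replace (j + L) with (j + 1 * L) by lia; now rewrite Nat.Div0.mod_add.
Qed.

Lemma c_ladj j : ladj (c j) (c (S j)).
Proof.
  destruct Hs as (_ & _ & H); rewrite cycle_arcs_seq in H; fold L in H.
  rewrite Forall_map, Forall_forall in H.
  pose proof L_pos.
  specialize (H (j mod L)); cbn [fst snd] in H.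
  rewrite Nat.Div0.mod_mod in H.
  replace (S (j mod L) mod L) with (S j mod L) in H.
  - apply arc_layered, H, in_seq; pose proof (Nat.mod_upper_bound j L); lia.
  - rewrite <- (Nat.add_1_r j), <- (Nat.add_1_r (j mod L)); symmetry; apply Nat.Div0.add_mod_idemp_l.
Qed.

Lemma c_layer j : c j / B = (c 0 / B + j) mod k.
Proof.
  induction j as [|j IH].
  - rewrite Nat.add_0_r, Nat.mod_small; [reflexivity|].
    destruct (c_ladj 0) as (H & _); apply Nat.Div0.div_lt_upper_bound; lia.
  - destruct (c_ladj j) as (_ & _ & H & _); rewrite H, IH.
    rewrite <- (Nat.add_1_r (_ mod _)), Nat.Div0.add_mod_idemp_l; f_equal; lia.
Qed.

(** Each arc advances the layer by one modulo k, so coming back to the first layer takes a positive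
    multiple of k arcs. *)
Lemma cycle_length_ge : 2 * S q + 1 <= length s.
Proof.
  fold k L; assert (H : c 0 / B = (c 0 / B + L) mod k)
    by (rewrite <- c_layer, <- (c_period 0); reflexivity).
  pose proof L_pos.
  destruct (Nat.le_gt_cases k L) as [Hk|Hk]; [exact Hk|exfalso].
  assert (Hi : c 0 / B < k).
  { destruct (c_ladj 0) as (Hc & _); apply Nat.Div0.div_lt_upper_bound; lia. }
  destruct (Nat.le_gt_cases k (c 0 / B + L)) as [Hk'|Hk'].
  - replace (c 0 / B + L) with (c 0 / B + L - k + 1 * k) in H by lia.
    rewrite Nat.Div0.mod_add, Nat.mod_small in H by lia; lia.
  - rewrite Nat.mod_small in H by lia; lia.
Qed.

(** An arc moves the surviving digits up by one place, so a digit of the current vertex becomes the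
    leading digit after as many steps as it has digits before it. *)
Lemma digit_c t : forall j, t <= q -> digit n (q - t) (c j mod B) = top (c (j + t)).
Proof.
  induction t as [|t IH]; intros j Ht.
  - rewrite Nat.sub_0_r, Nat.add_0_r; unfold top, digit; fold B.
    apply Nat.mod_small, Nat.Div0.div_lt_upper_bound.
    rewrite Nat.mul_comm, <- B_eq; apply Nat.mod_upper_bound; pose proof B_pos; lia.
  - replace (j + S t) with (S j + t) by lia; rewrite <- IH by lia.
    destruct (c_ladj j) as (_ & _ & _ & H).
    rewrite <- (digit_mod_pow n (q - S t) q (c j mod B)), <- H by lia.
    unfold digit; rewrite Nat.Div0.div_div, <- Nat.pow_succ_r'.
    do 3 f_equal; lia.
Qed.

Lemma lweight_c j :
  lweight (c j) (c (S j)) =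
  shift + sum_n (S q) (fun t => cost (top (c j)) (top (c (j + S t)))).
Proof.
  unfold lweight; f_equal.
  rewrite <- (sum_n_rev (S q) (fun t => cost (top (c j)) (top (c (j + t))))).
  apply sum_n_ext; intros i Hi; fold B; f_equal.
  replace i with (q - (q - i)) at 1 by lia.
  rewrite digit_c by lia; do 2 f_equal; lia.
Qed.

Lemma cycle_weight_sum :
  cycle_weight layered s = Z.of_nat (sum_n L (fun j => lweight (c j) (c (S j)))).
Proof.
  unfold cycle_weight; rewrite cycle_arcs_seq, map_map; fold L; cbn [fst snd].
  apply sumZ_seq; intros j _; apply arc_weight_layered, c_ladj.
Qed.

Lemma cycle_weight_ge : (Z.of_nat (length s * shift) <= cycle_weight layered s)%Z.
Proof.
  rewrite cycle_weight_sum; apply inj_le, sum_n_ge; intros; unfold lweight; lia.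
Qed.

(** Arc j pays for the pairs at distances 1 to l from position j. When the cycle goes around once,
    [cyclic_pair_sum] says that these are all pairs, each once. *)
Lemma cycle_weight_pair_sum : length s = 2 * S q + 1 ->
  cycle_weight layered s =
  Z.of_nat ((2 * S q + 1) * shift + pair_sum cost (map top s)).
Proof.
  intros HL; rewrite cycle_weight_sum; f_equal.
  rewrite (sum_n_ext L _ _ (fun j _ => lweight_c j)).
  rewrite sum_n_plus, sum_n_const; f_equal; [fold L in HL; now rewrite HL|].
  fold L in HL; rewrite HL.
  rewrite (cyclic_pair_sum cost (fun j => top (c j)) (S q) cost_sym).
  - f_equal; apply (nth_ext _ _ (top 0) (top 0)).
    + rewrite !length_map, length_seq; unfold L in HL; lia.
    + intros j Hj; rewrite length_map, length_seq in Hj.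
      rewrite map_nth, <- (map_map c top), map_nth; f_equal.
      rewrite nth_map_seq by exact Hj; unfold c.
      rewrite HL, Nat.mod_small by exact Hj; reflexivity.
  - intros i; now rewrite <- HL, c_period.
Qed.

Lemma top_lt : Forall (fun v => v < n) (map top s).
Proof.
  apply Forall_forall; intros v Hv; apply in_map_iff in Hv as (u & <- & _).
  unfold top; fold B; apply Nat.Div0.div_lt_upper_bound.
  rewrite Nat.mul_comm, <- B_eq; apply Nat.mod_upper_bound; pose proof B_pos; lia.
Qed.

End Cycle.

(** The entries of [vs] may coincide: the cycle is simple anyway, because its vertices lie in
    different layers. *)
Lemma cycle_of_tuple vs : length vs = 2 * S q + 1 -> Forall (fun v => v < n) vs ->
  exists s, directed_cycle layered s /\ length s = 2 * S q + 1 /\ map top s = vs.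
Proof.
  intros Hlen Hvs; fold k in Hlen |- *.
  set (v j := nth (j mod k) vs 0).
  assert (Hv : forall j, v j < n).
  { intros j; apply (proj1 (Forall_forall _ _) Hvs), nth_In; rewrite Hlen.
    apply Nat.mod_upper_bound; lia. }
  (* Digit i counts from the least significant end, whereas the first entry of the tuple is the most
     significant digit; hence q - i. *)
  set (d j i := v (j + (q - i))).
  assert (Hd : forall j i, d j i < n) by (intros; apply Hv).
  set (X j := from_digits n (S q) (d j)).
  assert (HX : forall j, X j < B) by (intros; apply from_digits_lt; auto).
  (* This provides the closing arc, from layer k-1 back to layer 0. *)
  assert (Hper : forall j, X (j mod k) = X j).
  { intros j; apply sum_n_ext; intros i _; f_equal; unfold d, v.
    now rewrite Nat.Div0.add_mod_idemp_l. }
  assert (Hdm : forall j, X j / n ^ q = v j /\ X j mod n ^ q = from_digits n q (d j)).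
  { intros j; change (X j) with (from_digits n q (d j) + d j q * n ^ q).
    rewrite Nat.add_comm.
    destruct (div_mod_add (d j q) (n ^ q) (from_digits n q (d j))) as [-> ->];
      [apply from_digits_lt; auto|].
    split; [unfold d; f_equal; lia|reflexivity]. }
  assert (Hdn : forall j, X (S j) / n = X j mod n ^ q).
  { intros j; rewrite (proj2 (Hdm j)); unfold X; rewrite from_digits_first.
    rewrite Nat.add_comm, Nat.mul_comm, (proj1 (div_mod_add _ _ _ (Hd (S j) 0))).
    apply sum_n_ext; intros i Hi; f_equal; unfold d; f_equal; lia. }
  set (f j := j * B + X j).
  exists (map f (seq 0 k)); split; [|split].
  - assert (Hf : forall j, f j / B = j /\ f j mod B = X j)
      by (intros; apply div_mod_add, HX).
    split; [unfold k; rewrite Nat.add_1_r; discriminate|split].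
    + apply NoDup_map_NoDup_ForallPairs; [|apply seq_NoDup].
      intros a b _ _ E; rewrite <- (proj1 (Hf a)), E; apply Hf.
    + rewrite cycle_arcs_seq, Forall_map, Forall_forall, length_map, length_seq.
      intros j Hj; apply in_seq in Hj; cbn [fst snd]; apply arc_layered.
      pose proof (Nat.mod_upper_bound (S j) k ltac:(lia)) as HSj.
      rewrite (Nat.mod_small j), !nth_map_seq by lia.
      unfold ladj; rewrite !(proj1 (Hf _)), !(proj2 (Hf _)), Hper, Hdn.
      repeat split; auto; unfold f; pose proof (HX j); pose proof (HX (S j mod k)); nia.
  - now rewrite length_map, length_seq.
  - rewrite map_map; apply (nth_ext _ _ (top (f 0)) 0);
      rewrite length_map, length_seq; [lia|].
    intros j Hj; rewrite nth_map_seq by exact Hj.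
    unfold top, f; fold B; rewrite (proj2 (div_mod_add _ _ _ (HX _))), (proj1 (Hdm _)).
    unfold v; now rewrite Nat.mod_small.
Qed.

End Layered.

(** * From cycles back to cliques *)

Definition wt (G : wgraph) (u v : nat) : nat := Z.to_nat (uweight G u v).

(** Instance weights are at least 1, so the value 0 of [wt] is free to mark a non-edge, the diagonal
    included. *)
Definition clique_cost (big : nat) (G : wgraph) (u v : nat) : nat :=
  wt G u v + (if wt G u v =? 0 then big else 0).

Definition index_pairs (k : nat) : list (nat * nat) :=
  flat_map (fun b => map (fun a => (a, b)) (seq 0 b)) (seq 0 k).

(** Phrased over [index_pairs] to match the flag that the decoding block computes, test by test. *)
Definition all_adjacent (G : wgraph) (r : list nat) : bool :=
  forallb (fun p => negb (wt G (nth (fst p) r 0) (nth (snd p) r 0) =? 0))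
    (index_pairs (length r)).

Lemma in_index_pairs k a b : In (a, b) (index_pairs k) <-> a < b < k.
Proof.
  unfold index_pairs; rewrite in_flat_map; split.
  - intros (b' & Hb & H); apply in_map_iff in H as (a' & E & Ha).
    injection E as -> ->; apply in_seq in Ha, Hb; lia.
  - intros H; exists b; split; [apply in_seq; lia|].
    apply in_map_iff; exists a; split; [reflexivity|apply in_seq; lia].
Qed.

Lemma ForallOrdPairs_nth (R : nat -> nat -> Prop) l :
  ForallOrdPairs R l <-> forall a b, a < b < length l -> R (nth a l 0) (nth b l 0).
Proof.
  induction l as [|x l IH]; split.
  - intros _ a b; cbn; lia.
  - constructor.
  - intros H a b Hab; inversion H as [|? ? H1 H2]; subst; cbn [length] in Hab.
    destruct b as [|b]; [lia|]; destruct a as [|a]; cbn [nth].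
    + apply (proj1 (Forall_forall _ _) H1), nth_In; lia.
    + apply IH; [exact H2|lia].
  - intros H; constructor.
    + apply Forall_forall; intros y Hy; apply (In_nth _ _ 0) in Hy as (b & Hb & <-).
      apply (H 0 (S b)); cbn; lia.
    + apply IH; intros a b Hab; apply (H (S a) (S b)); cbn; lia.
Qed.

Lemma pair_sum_le c s X :
  (forall u v, c u v <= X) -> pair_sum c s <= length s * length s * X.
Proof.
  intros Hc; induction s as [|v s IH]; [cbn; lia|]; cbn [pair_sum length].
  assert (H : list_sum (map (c v) s) <= length s * X).
  { clear IH; induction s as [|u s IH]; cbn; [lia|]; specialize (Hc v u).
    unfold list_sum in IH; lia. }
  nia.
Qed.

Lemma pair_sum_ge c s X (R : nat -> nat -> Prop) :
  (forall u v, R u v \/ X <= c u v) -> ForallOrdPairs R s \/ X <= pair_sum c s.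
Proof.
  intros Hc; induction s as [|v s IH]; [left; constructor|]; cbn [pair_sum].
  assert (H : Forall (R v) s \/ X <= list_sum (map (c v) s)).
  { clear IH; induction s as [|u s IH]; [left; constructor|].
    change (list_sum (map (c v) (u :: s))) with (c v u + list_sum (map (c v) s)).
    destruct (Hc v u) as [H|H]; [|lia]; destruct IH as [IH|IH]; [left; now constructor|lia]. }
  destruct H as [H|H]; [|lia]; destruct IH as [IH|IH]; [left; now constructor|lia].
Qed.

Lemma pair_sum_ext c c' s :
  ForallOrdPairs (fun u v => c u v = c' u v) s -> pair_sum c s = pair_sum c' s.
Proof.
  induction 1 as [|v s H _ IH]; [reflexivity|]; cbn [pair_sum]; rewrite IH; f_equal; f_equal.
  apply map_ext_in; intros u Hu; now apply (proj1 (Forall_forall _ _) H).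
Qed.

Lemma wt_sym G u v : wt G u v = wt G v u.
Proof. unfold wt, uweight; now rewrite Nat.min_comm, Nat.max_comm. Qed.

Lemma clique_cost_sym big G u v : clique_cost big G u v = clique_cost big G v u.
Proof. unfold clique_cost; now rewrite wt_sym. Qed.

Section Reduction.

Variables (G : wgraph) (W : nat).
Hypothesis HW : forall u v x, In (u, v, x) (edges G) -> (1 <= x <= Z.of_nat W)%Z.

Lemma uweight_spec u v :
  (uadj G u v /\ (1 <= uweight G u v <= Z.of_nat W)%Z) \/ (~ uadj G u v /\ uweight G u v = 0%Z).
Proof.
  unfold uadj, uweight, arc, arc_weight.
  set (a := Nat.min u v); set (b := Nat.max u v).
  destruct (find _ _) as [[[a' b'] x]|] eqn:E.
  - left; apply find_some in E as [Hi E]; cbn in E |- *.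
    apply andb_prop in E as [E1 E2]; apply Nat.eqb_eq in E1, E2; subst a' b'.
    split; [apply in_map_iff; exists (a, b, x); auto|now apply (HW a b)].
  - right; split; [|reflexivity]; intros H.
    apply in_map_iff in H as ([[a' b'] x] & Hab & Hi); cbn in Hab; injection Hab as -> ->.
    pose proof (find_none _ _ E _ Hi) as Hf; cbn in Hf; now rewrite !Nat.eqb_refl in Hf.
Qed.

Lemma uweight_wt u v : uweight G u v = Z.of_nat (wt G u v).
Proof. unfold wt; destruct (uweight_spec u v) as [[_ H]|[_ H]]; lia. Qed.

Lemma wt_le u v : wt G u v <= W.
Proof. unfold wt; destruct (uweight_spec u v) as [[_ H]|[_ H]]; lia. Qed.

Lemma uadj_wt u v : uadj G u v <-> wt G u v <> 0.
Proof.
  unfold wt; destruct (uweight_spec u v) as [[H1 H2]|[H1 H2]]; split; intros; auto; lia.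
Qed.

Hypothesis HG : is_ugraph G.

Lemma uadj_irrefl u : ~ uadj G u u.
Proof.
  unfold uadj; rewrite Nat.min_id, Nat.max_id; intros H.
  apply in_map_iff in H as ([[a b] x] & Hab & Hi); cbn in Hab; injection Hab as -> ->.
  apply (proj1 HG) in Hi; lia.
Qed.

Lemma clique_weight_pair_sum s : clique_weight G s = Z.of_nat (pair_sum (wt G) s).
Proof.
  induction s as [|v s IH]; [reflexivity|]; cbn [clique_weight pair_sum].
  rewrite IH, Nat2Z.inj_add; f_equal; clear IH; induction s as [|u s IH]; [reflexivity|].
  change (sumZ (map (uweight G v) (u :: s))) with (uweight G v u + sumZ (map (uweight G v) s))%Z.
  rewrite IH, uweight_wt.
  change (list_sum (map (wt G v) (u :: s))) with (wt G v u + list_sum (map (wt G v) s)); lia.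
Qed.

Variable big : nat.
Let cost := clique_cost big G.

Lemma pair_sum_cost_clique s :
  ForallOrdPairs (uadj G) s -> pair_sum cost s = pair_sum (wt G) s.
Proof.
  intros H; apply pair_sum_ext; induction H as [|v s H _ IH]; constructor; auto.
  revert H; apply Forall_impl; intros u Hu; apply uadj_wt, Nat.eqb_neq in Hu.
  unfold cost, clique_cost; rewrite Hu; lia.
Qed.

Variable q : nat.
Let k := 2 * S q + 1.
Hypothesis Hbig : k * k * W < big.

Lemma cost_le u v : cost u v <= big.
Proof.
  unfold cost, clique_cost; pose proof (wt_le u v).
  destruct (Nat.eqb_spec (wt G u v) 0); unfold k in Hbig; nia.
Qed.

Lemma all_adjacent_spec r : all_adjacent G r = true <-> ForallOrdPairs (uadj G) r.
Proof.
  rewrite ForallOrdPairs_nth; unfold all_adjacent; rewrite forallb_forall; split.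
  - intros H a b Hab; apply uadj_wt, Nat.eqb_neq.
    now apply Bool.negb_true_iff, (H (a, b)), in_index_pairs.
  - intros H [a b] Hab; cbn [fst snd]; apply Bool.negb_true_iff, Nat.eqb_neq, uadj_wt, H.
    now apply in_index_pairs.
Qed.

Definition clique_answer (r : list nat) : list nat := if all_adjacent G r then r else [].

Variable shift : nat.
Let G' := layered (order G) q shift cost.
Hypothesis Hn : 1 <= order G.
Hypothesis Hshift : k * k * big < shift.

(** Some k-cycle weighs at most k shift + k^2 big, which is less than (k+1) shift, and a longer
    cycle weighs at least that. Shorter cycles do not exist. *)
Lemma shortest_cycle_is_k_cycle s :
  min_solution (directed_cycle G') (cycle_weight G') s ->
  min_solution (fun s => directed_cycle G' s /\ length s = k) (cycle_weight G') s.
Proof.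
  (* The constant tuple is far from a clique, but it shows that there is a k-cycle at all. *)
  destruct (cycle_of_tuple (order G) q shift cost Hn (repeat 0 k)) as (s0 & C0 & L0 & T0).
  { apply repeat_length. }
  { apply Forall_forall; intros v Hv; apply repeat_spec in Hv; lia. }
  intros [[Hs Hmin]|[_ Hno]]; [left|now apply Hno in C0].
  split; [split; [exact Hs|]|intros s' [H _]; auto].
  pose proof (cycle_length_ge _ _ _ _ Hn s Hs) as HL.
  destruct (Nat.eq_dec (length s) k) as [E|E]; [exact E|exfalso].
  specialize (Hmin _ C0); unfold G', cost in Hmin, C0.
  pose proof (cycle_weight_ge _ _ _ _ Hn s Hs) as Hge.
  rewrite (cycle_weight_pair_sum _ _ _ _ Hn (clique_cost_sym big G) s0 C0 L0) in Hmin.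
  pose proof (pair_sum_le cost (map (top (order G) q) s0) big cost_le) as Hle.
  rewrite length_map, L0 in Hle; fold k in Hle, HL, Hmin; fold G' in Hge; fold cost in Hmin; fold G' in Hmin.
  assert (length s * shift <= k * shift + pair_sum cost (map (top (order G) q) s0)) by lia.
  nia.
Qed.

Lemma k_cycle_answer s :
  min_solution (fun s => directed_cycle G' s /\ length s = k) (cycle_weight G') s ->
  length s = k /\
  min_solution (clique G k) (clique_weight G) (clique_answer (map (top (order G) q) s)).
Proof.
  destruct (cycle_of_tuple (order G) q shift cost Hn (repeat 0 k)) as (s0 & C0 & L0 & _).
  { apply repeat_length. }
  { apply Forall_forall; intros v Hv; apply repeat_spec in Hv; lia. }
  intros [[[Hs HL] Hmin]|[_ Hno]]; [|now exfalso; apply (Hno s0)].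
  split; [exact HL|].
  set (r := map (top (order G) q) s) in *.
  (* A clique is one of the tuples, so its k-cycle competes with [s]; both weights contain the same
     multiple of [shift], and on a clique [cost] is the true weight. *)
  assert (Hlow : forall s', clique G k s' -> pair_sum cost r <= pair_sum (wt G) s').
  { intros s' (H1 & H2 & H3 & H4).
    destruct (cycle_of_tuple (order G) q shift cost Hn s' H1 H3) as (c' & C1 & C2 & C3).
    specialize (Hmin c' (conj C1 C2)); unfold G', cost in Hmin.
    rewrite !(cycle_weight_pair_sum _ _ _ _ Hn (clique_cost_sym big G)) in Hmin by assumption.
    rewrite C3 in Hmin; fold r cost in Hmin; rewrite <- pair_sum_cost_clique by exact H4; lia. }
  unfold clique_answer; destruct (all_adjacent G r) eqn:E.
  - left; apply all_adjacent_spec in E; split.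
    + split; [unfold r; now rewrite length_map|]; split; [|split].
      (* A repeated vertex would be adjacent to itself. *)
      * apply NoDup_iff_ForallOrdPairs; apply ForallOrdPairs_nth; intros a b Hab Eab.
        apply (proj1 (ForallOrdPairs_nth _ _) E) in Hab; rewrite Eab in Hab.
        now apply uadj_irrefl in Hab.
      * apply top_lt; auto.
      * exact E.
    + intros s' Hs'; rewrite !clique_weight_pair_sum, <- (pair_sum_cost_clique r E).
      specialize (Hlow s' Hs'); lia.
  - right; split; [reflexivity|]; intros s' Hs'.
    specialize (Hlow s' Hs').
    (* A tuple with a non-adjacent pair costs at least [big], more than the at most k^2 W of a
       clique; so by [Hlow] there is no clique. *)
    destruct (pair_sum_ge cost r big (uadj G)) as [H|H].
    + intros u v; rewrite uadj_wt; unfold cost, clique_cost.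
      destruct (Nat.eqb_spec (wt G u v) 0); lia.
    + apply all_adjacent_spec in H; congruence.
    + pose proof (pair_sum_le (wt G) s' W wt_le) as Hle.
      destruct Hs' as [Hl _]; rewrite Hl in Hle; fold k in Hbig; nia.
Qed.

End Reduction.

(** * Evaluation without overflow *)

(** The bound travels with the value, so that correctness of an expression reduces to one inequality
    per sum or product. *)
Definition evn (w : nat) (s : env) (e : expr) (x : nat) : Prop :=
  ev w s e = Z.of_nat x /\ x < 2 ^ w.

Lemma of_nat_range w x : x < 2 ^ w -> (0 <= Z.of_nat x < 2 ^ Z.of_nat w)%Z.
Proof. intros H; change 2%Z with (Z.of_nat 2); rewrite <- Nat2Z.inj_pow; lia. Qed.

Lemma wrap_of_nat w x : wrap w (Z.of_nat x) = Z.of_nat (x mod 2 ^ w).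
Proof. unfold wrap; now rewrite Nat2Z.inj_mod, Nat2Z.inj_pow. Qed.

Lemma wrap_of_nat_small w x : x < 2 ^ w -> wrap w (Z.of_nat x) = Z.of_nat x.
Proof. intros H; now apply wrap_small, of_nat_range. Qed.

Lemma evn_const w s c : c < 2 ^ w -> evn w s (EConst c) c.
Proof. intros H; split; [now apply wrap_of_nat_small|exact H]. Qed.

Lemma evn_var w s x a : fst s x = Z.of_nat a -> a < 2 ^ w -> evn w s (EVar x) a.
Proof. intros E H; split; [cbn; rewrite E; now apply wrap_of_nat_small|exact H]. Qed.

Lemma evn_load w s e a y :
  evn w s e a -> snd s (Z.of_nat a) = Z.of_nat y -> y < 2 ^ w -> evn w s (ELoad e) y.
Proof. intros [E _] H1 H2; split; [cbn; now rewrite E|exact H2]. Qed.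

Lemma evn_op w s o e1 e2 a b x :
  evn w s e1 a -> evn w s e2 b ->
  eval_binop o (Z.of_nat a) (Z.of_nat b) = Z.of_nat x -> x < 2 ^ w ->
  evn w s (EOp o e1 e2) x.
Proof.
  intros [E1 _] [E2 _] E H; split; [|exact H].
  cbn [ev]; rewrite E1, E2, E; now apply wrap_of_nat_small.
Qed.

Lemma evn_add w s e1 e2 a b :
  evn w s e1 a -> evn w s e2 b -> a + b < 2 ^ w -> evn w s (EOp OAdd e1 e2) (a + b).
Proof. intros; eapply evn_op; eauto; cbn; lia. Qed.

Lemma evn_sub w s e1 e2 a b :
  evn w s e1 a -> evn w s e2 b -> b <= a -> evn w s (EOp OSub e1 e2) (a - b).
Proof. intros [H1 H1'] H2 H; eapply evn_op; eauto; [split; eauto|cbn; lia|lia]. Qed.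

Lemma evn_mul w s e1 e2 a b :
  evn w s e1 a -> evn w s e2 b -> a * b < 2 ^ w -> evn w s (EOp OMul e1 e2) (a * b).
Proof. intros; eapply evn_op; eauto; cbn; lia. Qed.

Lemma div_le_self a b : a / b <= a.
Proof. destruct b; [cbn; lia|]; apply Nat.Div0.div_le_upper_bound; lia. Qed.

Lemma evn_div w s e1 e2 a b :
  evn w s e1 a -> evn w s e2 b -> evn w s (EOp ODiv e1 e2) (a / b).
Proof.
  intros [H1 H1'] H2; eapply evn_op; eauto; [split; eauto| |].
  - cbn; now rewrite Nat2Z.inj_div.
  - pose proof (div_le_self a b); lia.
Qed.

Lemma evn_mod w s e1 e2 a b :
  evn w s e1 a -> evn w s e2 b -> evn w s (EOp OMod e1 e2) (a mod b).
Proof.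
  intros [H1 H1'] H2; eapply evn_op; eauto; [split; eauto| |].
  - cbn; now rewrite Nat2Z.inj_mod.
  - pose proof (Nat.Div0.mod_le a b); lia.
Qed.

Lemma evn_lt w s e1 e2 a b :
  evn w s e1 a -> evn w s e2 b -> 1 < 2 ^ w ->
  evn w s (EOp OLt e1 e2) (if a <? b then 1 else 0).
Proof.
  intros; eapply evn_op; eauto; cbn [eval_binop].
  - destruct (Nat.ltb_spec a b), (Z.ltb_spec (Z.of_nat a) (Z.of_nat b)); auto; lia.
  - destruct (a <? b); lia.
Qed.

Lemma evn_eq w s e1 e2 a b :
  evn w s e1 a -> evn w s e2 b -> 1 < 2 ^ w ->
  evn w s (EOp OEq e1 e2) (if a =? b then 1 else 0).
Proof.
  intros; eapply evn_op; eauto; cbn [eval_binop].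
  - destruct (Nat.eqb_spec a b), (Z.eqb_spec (Z.of_nat a) (Z.of_nat b)); auto; lia.
  - destruct (a =? b); lia.
Qed.

Lemma evn_mask w w' s e1 e2 a :
  evn w s e1 a -> evn w s e2 (2 ^ w' - 1) -> evn w s (EOp OAnd e1 e2) (a mod 2 ^ w').
Proof.
  intros [H1 H1'] H2; eapply evn_op; eauto; [split; eauto| |].
  - cbn; rewrite Nat2Z.inj_mod, Nat2Z.inj_pow, Nat2Z.inj_sub, Nat2Z.inj_pow
      by (pose proof (Nat.pow_nonzero 2 w'); lia).
    change (Z.of_nat 2) with 2%Z; change (Z.of_nat 1) with 1%Z.
    rewrite <- Z.land_ones, Z.ones_equiv by lia; f_equal; lia.
  - pose proof (Nat.Div0.mod_le a (2 ^ w')); lia.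
Qed.

Lemma exec_assign w x e a b s :
  evn w s e a ->
  exec_block w (SAssign x e :: b) s = exec_block w b (set_reg (fst s) x (Z.of_nat a), snd s).
Proof.
  intros [E H]; unfold exec_block; cbn [fold_left exec_stm]; rewrite E.
  now rewrite wrap_of_nat_small.
Qed.

Lemma exec_store w e1 e2 a1 a2 b s :
  evn w s e1 a1 -> evn w s e2 a2 ->
  exec_block w (SStore e1 e2 :: b) s =
  exec_block w b (fst s, set_mem (snd s) (Z.of_nat a1) (Z.of_nat a2)).
Proof. intros [E1 _] [E2 _]; unfold exec_block; cbn; now rewrite E1, E2. Qed.

Lemma exec_block_nil w s : exec_block w [] s = s.
Proof. reflexivity. Qed.

Lemma exec_block_app w b1 b2 s :
  exec_block w (b1 ++ b2) s = exec_block w b2 (exec_block w b1 s).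
Proof. apply fold_left_app. Qed.

Definition repeat_block (t : nat) (b : list stm) : list stm := concat (repeat b t).

Lemma exec_repeat_block w t b s :
  exec_block w (repeat_block t b) s = Nat.iter t (exec_block w b) s.
Proof.
  revert s; induction t as [|t IH]; intros s; [reflexivity|].
  unfold repeat_block; cbn [repeat concat]; rewrite exec_block_app.
  rewrite Nat.iter_succ_r; apply IH.
Qed.

Lemma iter_invariant (A : Type) (Inv : nat -> A -> Prop) (f : A -> A) J s :
  Inv 0 s -> (forall j s, j < J -> Inv j s -> Inv (S j) (f s)) ->
  forall j, j <= J -> Inv j (Nat.iter j f s).
Proof.
  intros H0 HS; induction j as [|j IH]; intros Hj; [exact H0|].
  apply (HS j); [lia|apply IH; lia].
Qed.

Definition vars_are (vals : list nat) (s : env) : Prop :=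
  forall x, x < length vals -> fst s x = Z.of_nat (nth x vals 0).

Lemma vars_are_set vals v m x z m' :
  vars_are vals (v, m) -> length vals <= x -> vars_are vals (set_reg v x z, m').
Proof.
  intros H Hx y Hy; cbn [fst]; rewrite set_reg_neq by lia; exact (H y Hy).
Qed.

Lemma vars_are_mem vals v m m' : vars_are vals (v, m) -> vars_are vals (v, m').
Proof. exact (fun H => H). Qed.

Lemma vars_are_var vals w s x a :
  vars_are vals s -> x < length vals -> nth x vals 0 = a -> a < 2 ^ w -> evn w s (EVar x) a.
Proof. intros H Hx Ha Hlt; apply evn_var; [rewrite H, Ha; auto|exact Hlt]. Qed.

(** * The program *)

Local Notation "a +' b" := (EOp OAdd a b) (at level 50, left associativity).
Local Notation "a *' b" := (EOp OMul a b) (at level 40, left associativity).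
Local Notation "a /' b" := (EOp ODiv a b) (at level 40, left associativity).
Local Notation "a %' b" := (EOp OMod a b) (at level 40, left associativity).
Local Notation "a <' b" := (EOp OLt a b) (at level 70, no associativity).
Local Notation "a &' b" := (EOp OAnd a b) (at level 55, left associativity).
Local Notation "x <- e" := (SAssign x e) (at level 80, no associativity).
Local Notation "a <=: e" := (SStore a e) (at level 80, no associativity).

(* With k = 2l+1 and q = l-1: [vA] = n^q, [vB] = n^l, [vN] = k n^l vertices and
   [vM] = k n^(l+1) arcs of the layered graph, [vp] = least power of two above [vN],
   [vmask] = [vp]^C - 1 for the word length of the simulated machine, [vH] = address of the
   adjacency matrix (a 0 entry means no edge), [vbig] = price of a non-edge, [vshift] =
   constant added to every arc, [ve] = loop counter. *)
Definition vn := EVar 0.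
Definition vm := EVar 1.
Definition vA := EVar 2.
Definition vB := EVar 3.
Definition vN := EVar 4.
Definition vM := EVar 5.
Definition vp := EVar 6.
Definition vmask := EVar 7.
Definition vH := EVar 8.
Definition vbig := EVar 9.
Definition vshift := EVar 10.
Definition ve := EVar 11.

Definition sizes_block (q : nat) : list stm :=
  [0 <- ELoad (EConst 0); 1 <- ELoad (EConst 1); 2 <- EConst 1] ++
  repeat_block q [2 <- vA *' vn] ++
  [3 <- vA *' vn; 4 <- EConst (2 * S q + 1) *' vB; 5 <- vN *' vn; 6 <- EConst 1].

Definition power_body : list stm := [6 <- vp +' vp].

(** In powers of p these are H = p^(C+3), [big] = p^(D+2) and [shift] = p^(D+5). As k, n <= N < p,
    this yields big > k^2 n^D and shift > k^2 big, and H exceeds both p^C and the length of the new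
    encoding. Variable 7 holds p^C itself until H has been computed. *)
Definition constants_block (C D : nat) : list stm :=
  [7 <- EConst 1] ++ repeat_block C [7 <- vmask *' vp] ++
  [8 <- vmask *' vp *' vp *' vp; 7 <- EOp OSub vmask (EConst 1); 9 <- vp *' vp] ++
  repeat_block D [9 <- vbig *' vp] ++
  [10 <- vbig *' vp *' vp *' vp; 11 <- EConst 0].

Definition matrix_body : list stm :=
  [12 <- ELoad (EConst 3 *' ve +' EConst 2);
   13 <- ELoad (EConst 3 *' ve +' EConst 3);
   14 <- ELoad (EConst 3 *' ve +' EConst 4);
   vH +' EVar 12 *' vn +' EVar 13 <=: EVar 14;
   vH +' EVar 13 *' vn +' EVar 12 <=: EVar 14;
   11 <- ve +' EConst 1].

(** Run only after the matrix is complete, since it begins to overwrite the input. Values are masked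
    because the simulated machine would see its input reduced to short words. *)
Definition header_block : list stm :=
  [EConst 0 <=: vN &' vmask; EConst 1 <=: vM &' vmask; 11 <- EConst 0].

Definition digit_body : list stm :=
  [17 <- ELoad (EVar 15 +' EVar 14 %' vn);
   16 <- EVar 16 +' (EVar 17 +' EOp OEq (EVar 17) (EConst 0) *' vbig);
   14 <- EVar 14 /' vn].

(** Scratch variables: 12 is the layer, 13 the window of l+1 digits, 14 the target tuple, consumed
    digit by digit from its least significant end, 15 the matrix row of the dropped vertex, 16 the
    accumulated weight and 17 the current entry. *)
Definition arc_body (q : nat) : list stm :=
  [12 <- ve /' (vB *' vn);
   13 <- ve %' (vB *' vn);
   14 <- EVar 13 %' vB;
   EConst 3 *' ve +' EConst 2 <=: (EVar 12 *' vB +' EVar 13 /' vn) &' vmask;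
   EConst 3 *' ve +' EConst 3 <=:
     ((EVar 12 +' EConst 1) %' EConst (2 * S q + 1) *' vB +' EVar 14) &' vmask;
   15 <- vH +' EVar 13 /' vn /' vA *' vn;
   16 <- vshift] ++
  repeat_block (S q) digit_body ++
  [EConst 3 *' ve +' EConst 4 <=: EVar 16 &' vmask;
   11 <- ve +' EConst 1].

Definition build_segs (q C D : nat) : list seg :=
  [Block (sizes_block q); Loop (vp <' vN +' EConst 1) power_body;
   Block (constants_block C D); Loop (ve <' vm) matrix_body;
   Block header_block; Loop (ve <' vM) (arc_body q)].

Definition decode_stm (j : nat) : stm := EConst j <=: ELoad (EConst j) %' vB /' vA.

(** Branch-free: the flag in variable 11 is multiplied by an indicator, and at the end the output
    length is the flag times k. *)
Definition check_stm (p : nat * nat) : stm :=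
  11 <- ve *' (EConst 0 <' ELoad (vH +' ELoad (EConst (S (fst p))) *' vn +'
                                   ELoad (EConst (S (snd p))))).

Definition decode_block (q : nat) : list stm :=
  map decode_stm (seq 1 (2 * S q + 1)) ++ [11 <- EConst 1] ++
  map check_stm (index_pairs (2 * S q + 1)) ++
  [EConst 0 <=: ve *' EConst (2 * S q + 1)].

Ltac evn_step Hv :=
  lazymatch goal with
  | |- evn _ _ (EConst _) _ => apply evn_const
  | |- evn _ _ (EVar _) _ =>
      first [ apply (vars_are_var _ _ _ _ _ Hv); [cbn; lia|reflexivity|]
            | apply evn_var; [reflexivity|] ]
  | |- evn _ _ (EOp OAdd _ _) _ => apply evn_add
  | |- evn _ _ (EOp OMul _ _) _ => apply evn_mul
  | |- evn _ _ (EOp ODiv _ _) _ => apply evn_div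
  | |- evn _ _ (EOp OMod _ _) _ => apply evn_mod
  | |- evn _ _ (EOp OLt _ _) _ => apply evn_lt
  | |- evn _ _ (EOp OEq _ _) _ => apply evn_eq
  | |- evn _ _ ?e _ => unfold e
  end.

(** * The input as seen by the program *)

Lemma nth_flat_map_triples (A : Type) (f : A -> list Z) l j i d :
  (forall x, length (f x) = 3) -> j < length l -> i < 3 ->
  nth (3 * j + i) (flat_map f l) 0%Z = nth i (f (nth j l d)) 0%Z.
Proof.
  intros Hf; revert j; induction l as [|x l IH]; intros j Hj Hi; cbn [length] in Hj; [lia|].
  cbn [flat_map]; destruct j as [|j].
  - rewrite app_nth1 by (rewrite Hf; lia); f_equal; lia.
  - rewrite app_nth2 by (rewrite Hf; lia); rewrite Hf.
    replace (3 * S j + i - 3) with (3 * j + i) by lia; apply IH; lia.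
Qed.

Lemma length_encode G : length (encode G) = 2 + 3 * num_edges G.
Proof.
  unfold encode, num_edges; cbn [length]; do 2 f_equal.
  induction (edges G) as [|[[u v] x] l IH]; [reflexivity|].
  cbn [flat_map length app]; rewrite IH; lia.
Qed.

Lemma nth_encode G j u v x d :
  j < num_edges G -> nth j (edges G) d = (u, v, x) ->
  nth (3 * j + 2) (encode G) 0%Z = Z.of_nat u /\
  nth (3 * j + 3) (encode G) 0%Z = Z.of_nat v /\
  nth (3 * j + 4) (encode G) 0%Z = x.
Proof.
  intros Hj E; unfold encode.
  replace (3 * j + 2) with (S (S (3 * j + 0))) by lia.
  replace (3 * j + 3) with (S (S (3 * j + 1))) by lia.
  replace (3 * j + 4) with (S (S (3 * j + 2))) by lia; cbn [nth].
  assert (Hlen : forall y : nat * nat * Z,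
    length (let '(u, v, x) := y in [Z.of_nat u; Z.of_nat v; x]) = 3)
    by (intros [[? ?] ?]; reflexivity).
  rewrite !(nth_flat_map_triples _ _ _ j _ d Hlen), E by (auto; lia); auto.
Qed.

Lemma arc_weight_snoc n l u v x a b :
  ~ In (u, v) (map fst l) ->
  arc_weight (WGraph n (l ++ [(u, v, x)])) a b =
  if ((u =? a) && (v =? b))%bool then x else arc_weight (WGraph n l) a b.
Proof.
  unfold arc_weight; cbn [edges]; induction l as [|[[c d] y] l IH]; intros Hn.
  - cbn; destruct ((u =? a) && (v =? b))%bool; reflexivity.
  - cbn in Hn |- *; destruct ((c =? a) && (d =? b))%bool eqn:E.
    + destruct ((u =? a) && (v =? b))%bool eqn:E'; [|reflexivity].
      apply andb_prop in E, E'; rewrite !Nat.eqb_eq in E, E'.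
      exfalso; apply Hn; left; f_equal; intuition congruence.
    + apply IH; auto.
Qed.

(** One round of the matrix loop: reading one more edge changes just the two symmetric entries. As
    no edge is listed twice, the new one is not hidden by an earlier match of [find]. *)
Lemma wt_firstn G j u v x d a b :
  is_ugraph G -> j < num_edges G -> nth j (edges G) d = (u, v, x) ->
  wt (WGraph (order G) (firstn (S j) (edges G))) a b =
  if ((a =? u) && (b =? v) || (a =? v) && (b =? u))%bool then Z.to_nat x
  else wt (WGraph (order G) (firstn j (edges G))) a b.
Proof.
  intros [HG1 HG2] Hj E.
  assert (Hsplit : edges G = firstn j (edges G) ++ (u, v, x) :: skipn (S j) (edges G)).
  { rewrite <- E; clear -Hj; unfold num_edges in Hj; revert j Hj.
    induction (edges G) as [|y l IH]; intros [|j] Hj; cbn in *; try lia; [reflexivity|].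
    f_equal; apply IH; lia. }
  assert (Huv : u < v) by (apply (HG1 u v x); rewrite Hsplit; apply in_elt).
  assert (Hnew : ~ In (u, v) (map fst (firstn j (edges G)))).
  { rewrite Hsplit, map_app in HG2; cbn [map fst] in HG2.
    apply NoDup_remove_2 in HG2; intros H; apply HG2, in_or_app; now left. }
  assert (Hf : firstn (S j) (edges G) = firstn j (edges G) ++ [(u, v, x)]).
  { clear -Hj E; unfold num_edges in Hj; revert j Hj E.
    induction (edges G) as [|y l IH]; intros [|j] Hj E; cbn in *; try lia.
    - now rewrite E.
    - f_equal; apply IH; auto; lia. }
  unfold wt, uweight; rewrite Hf, arc_weight_snoc by exact Hnew.
  destruct (Nat.eqb_spec u (Nat.min a b)), (Nat.eqb_spec v (Nat.max a b)),
    (Nat.eqb_spec a u), (Nat.eqb_spec b v), (Nat.eqb_spec a v), (Nat.eqb_spec b u);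
    cbn; try reflexivity; lia.
Qed.

Lemma ugraph_num_edges G : is_ugraph G -> num_edges G <= order G * order G.
Proof.
  intros [H1 H2]; unfold num_edges; rewrite <- (length_map fst).
  replace (order G * order G) with (length (list_prod (seq 0 (order G)) (seq 0 (order G))))
    by (now rewrite length_prod, !length_seq).
  apply NoDup_incl_length; [exact H2|].
  intros [u v] H; apply in_map_iff in H as ([[a b] x] & E & Hi); cbn in E; injection E as -> ->.
  apply H1 in Hi; apply in_prod; apply in_seq; lia.
Qed.

Lemma index_inj n a b c d : b < n -> d < n -> a * n + b = c * n + d -> a = c /\ b = d.
Proof.
  intros Hb Hd E.
  destruct (div_mod_add a n b Hb) as [E1 E2], (div_mod_add c n d Hd) as [E3 E4].
  rewrite E in E1, E2; lia.
Qed.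

Ltac vars_tac :=
  let x := fresh "x" in let Hx := fresh "Hx" in
  intros x Hx; cbn [length] in Hx;
  do 18 (try (destruct x as [|x];
    [first [reflexivity
           |match goal with Hv : vars_are _ _ |- fst _ ?y = _ =>
              exact (Hv y ltac:(cbn [length]; lia)) end]|]));
  exfalso; lia.

(** * Correctness of the construction *)

Section Build.

(** All sizes are variables tied by equations, so that the arithmetic tactics meet atoms instead of
    nested powers; the instantiation later supplies the defining equations by [eq_refl]. *)
Variables (G : wgraph) (q C D w w' : nat) (n m k A B N M p hC H big shift W : nat).
Hypothesis HG : is_ugraph G.
Hypothesis HW : forall u v x, In (u, v, x) (edges G) -> (1 <= x <= Z.of_nat W)%Z.
Hypothesis Hn : 1 <= n.
Hypothesis n_eq : n = order G.
Hypothesis m_eq : m = num_edges G.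
Hypothesis k_eq : k = 2 * S q + 1.
Hypothesis A_eq : A = n ^ q.
Hypothesis B_eq' : B = A * n.
Hypothesis N_eq : N = k * B.
Hypothesis M_eq : M = N * n.
Hypothesis p_eq : p = 2 ^ S (Nat.log2 N).
Hypothesis hC_eq : hC = p ^ C.
Hypothesis w'_eq : hC = 2 ^ w'.
Hypothesis H_eq : H = hC * p * p * p.
Hypothesis big_eq : big = p * p * p ^ D.
Hypothesis shift_eq : shift = big * p * p * p.
Hypothesis W_eq : W = n ^ D.
Hypothesis Hw1 : hC * p * p * p * p <= 2 ^ w.
Hypothesis Hw2 : big * p * p * p * p <= 2 ^ w.

Let cost := clique_cost big G.
Let G' := layered n q shift cost.
Let mem0 : Z -> Z := mem (init_state w (encode G)).
Let consts := [n; m; A; B; N; M; p; hC - 1; H; big; shift].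

Lemma size_facts :
  N < p /\ 4 <= p /\ p <= 2 * N /\ 1 <= A /\ A <= B /\ n <= B /\ k <= N /\ B <= N /\ 3 <= k /\
  S q <= k /\ m <= n * n /\ N <= M /\ B * n <= M /\ n * n <= M /\ M <= p * p /\ 3 * M + 5 <= p * p * p /\
  1 <= hC /\ 1 <= p ^ D /\ W <= p ^ D.
Proof.
  assert (HA : 1 <= A) by (rewrite A_eq; pose proof (Nat.pow_nonzero n q); lia).
  assert (Hk : 3 <= k) by lia.
  assert (HN : 3 <= N) by nia.
  destruct (Nat.log2_spec N ltac:(lia)) as [L1 L2]; rewrite <- p_eq in L2.
  assert (Hp2 : p = 2 * 2 ^ Nat.log2 N) by (rewrite p_eq; apply Nat.pow_succ_r').
  assert (Hnp : n <= p) by nia.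
  assert (W <= p ^ D) by (rewrite W_eq; apply Nat.pow_le_mono_l, Hnp).
  assert (1 <= p ^ D) by (pose proof (Nat.pow_nonzero p D); lia).
  assert (1 <= hC) by (rewrite hC_eq; pose proof (Nat.pow_nonzero p C); lia).
  assert (m <= n * n) by (rewrite m_eq, n_eq; apply ugraph_num_edges, HG).
  assert (Hp4 : 4 <= p).
  { destruct (Nat.log2 N) as [|[|t]] eqn:E; [cbn in *; lia|cbn in Hp2; lia|].
    rewrite !Nat.pow_succ_r' in Hp2; pose proof (Nat.pow_nonzero 2 t); lia. }
  assert (HnB : n <= B) by (clear - B_eq' HA; nia).
  assert (HBN : B <= N) by (clear - N_eq Hk; nia).
  assert (HkN : k <= N) by (clear - N_eq HnB Hn; nia).
  (* M = N n with n <= N < p. The sharper factor p - 1 leaves room for 3M + 5 <= p^3 when p >= 4,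
     which places the whole encoding below H. *)
  assert (HM : M <= (p - 1) * (p - 1)) by (clear - M_eq L2 HnB HBN; rewrite M_eq; nia).
  assert (N <= M /\ B * n <= M /\ n * n <= M)
    by (clear - M_eq Hn HnB HBN; rewrite M_eq; nia).
  assert (M <= p * p /\ 3 * M + 5 <= p * p * p) by (clear - HM Hp4; split; nia).
  assert (A <= B) by (clear - B_eq' Hn; nia).
  repeat split; lia.
Qed.

Lemma word_facts :
  1 < 2 ^ w /\ p < 2 ^ w /\ 3 * M + 5 < 2 ^ w /\ H + n * n < 2 ^ w /\ hC < 2 ^ w /\ H < 2 ^ w /\
  big < 2 ^ w /\ shift + k * big < 2 ^ w /\ W < big /\ k * k * W < big /\ k * k * big < shift /\
  2 + 3 * M <= H /\ hC <= H.
Proof.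
  destruct size_facts as (F1 & F2 & F3 & F4 & F5 & F6 & F7 & F8 & F9 & F10 & F11 & F12 & F13 &
    F14 & F15 & F16 & F17 & F18 & F19).
  assert (Hpp : 16 <= p * p) by (clear - F2; nia).
  assert (Hppp : 64 <= p * p * p) by (clear - F2 Hpp; nia).
  assert (HH : p * p * p <= H) by (clear - H_eq F17; rewrite H_eq, <- !Nat.mul_assoc; nia).
  assert (HhC : hC * p <= H) by (clear - H_eq Hpp; rewrite H_eq; nia).
  assert (HH4 : H * p <= 2 ^ w) by (rewrite H_eq; exact Hw1).
  assert (Hbig : p * p <= big) by (clear - big_eq F18; rewrite big_eq; nia).
  assert (Hnn : n * n <= p * p) by (clear - F1 F6 F8; nia).
  assert (Hkk : k * k < p * p) by (clear - F1 F7; nia).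
  assert (HWb : k * k * W < big) by (clear - big_eq Hkk F18 F19; rewrite big_eq; nia).
  assert (HW1 : W < big).
  { apply Nat.le_lt_trans with (2 := HWb); assert (1 <= k * k) by (clear - F9; nia); clear - H0; nia. }
  assert (Hs4 : shift * p <= 2 ^ w) by (rewrite shift_eq; exact Hw2).
  assert (Hs : p * p * big * p = shift) by (rewrite shift_eq; ring).
  assert (Hs' : k * k * big < shift).
  { apply Nat.lt_le_trans with (p * p * big); [apply Nat.mul_lt_mono_pos_r; lia|].
    rewrite <- Hs; generalize (p * p * big); clear - F2; nia. }
  assert (Hk : k * big <= k * k * big) by (rewrite <- Nat.mul_assoc; generalize (k * big); clear - F9; nia).
  assert (2 * shift <= 2 ^ w) by (clear - Hs4 F2; nia).
  assert (4 * H <= 2 ^ w) by (clear - HH4 F2; nia).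
  assert (hC * 1 <= hC * p) by (clear - F2; nia).
  assert (p * p <= p * p * p) by (clear - F2; nia).
  assert (big <= k * big) by (clear - F9; nia).
  assert (p <= p * p) by (clear - F2; nia).
  repeat split; lia.
Qed.

Ltac facts :=
  destruct size_facts as (F1 & F2 & F3 & F4 & F5 & F6 & F7 & F8 & F9 & F10 & F11 & F12 & F13 &
    F14 & F15 & F16 & F17 & F18 & F19);
  destruct word_facts as (U1 & U2 & U3 & U4 & U5 & U6 & U7 & U8 & U9 & U10 & U11 & U12 & U13).

Lemma mem0_at a : mem0 (Z.of_nat a) = wrap w (nth a (encode G) 0%Z).
Proof.
  unfold mem0; cbn [mem init_state].
  rewrite (proj2 (Z.ltb_ge _ _)), Nat2Z.id by lia; reflexivity.
Qed.

Lemma sizes_correct :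
  let s := exec_block w (sizes_block q) (fun _ => 0%Z, mem0) in
  vars_are [n; m; A; B; N; M; 1] s /\ snd s = mem0.
Proof.
  facts; cbv zeta; unfold sizes_block; rewrite !exec_block_app, exec_repeat_block.
  assert (E0 : mem0 (Z.of_nat 0) = Z.of_nat n).
  { rewrite mem0_at; cbn [nth encode]; rewrite <- n_eq; apply wrap_of_nat_small; lia. }
  assert (E1 : mem0 (Z.of_nat 1) = Z.of_nat m).
  { rewrite mem0_at; cbn [nth encode]; rewrite <- m_eq; apply wrap_of_nat_small; lia. }
  rewrite (exec_assign w 0 _ n)
    by (apply (evn_load _ _ _ 0); [apply evn_const; lia|exact E0|lia]).
  rewrite (exec_assign w 1 _ m)
    by (apply (evn_load _ _ _ 1); [apply evn_const; lia|exact E1|lia]).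
  rewrite (exec_assign w 2 _ 1) by (apply evn_const; lia).
  rewrite exec_block_nil; cbn [fst snd].
  set (s1 := (_, mem0) : env).
  assert (I : vars_are [n; m; n ^ q] (Nat.iter q (exec_block w [SAssign 2 (EOp OMul vA vn)]) s1) /\
    snd (Nat.iter q (exec_block w [SAssign 2 (EOp OMul vA vn)]) s1) = mem0).
  { apply (iter_invariant _ (fun j s => vars_are [n; m; n ^ j] s /\ snd s = mem0) _ q); [| |lia].
    - split; [vars_tac|reflexivity].
    - intros j [v mm] Hj [Hv Hm].
      assert (Hpow : n ^ S j <= A) by (rewrite A_eq; apply Nat.pow_le_mono_r; lia).
      assert (Hpow' : n ^ j <= A) by (rewrite A_eq; apply Nat.pow_le_mono_r; lia).
      rewrite Nat.pow_succ_r', Nat.mul_comm in Hpow |- *.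
      rewrite (exec_assign w 2 _ (n ^ j * n)) by (repeat evn_step Hv; lia).
      split; [rewrite exec_block_nil; cbn [fst snd]; vars_tac|exact Hm]. }
  destruct (Nat.iter q _ s1) as [v mm]; destruct I as [Hv Hm]; cbn [snd] in Hm; subst mm.
  rewrite <- A_eq in Hv.
  rewrite (exec_assign w 3 _ B) by (rewrite B_eq'; repeat evn_step Hv; rewrite <- ?B_eq'; lia).
  rewrite (exec_assign w 4 _ N).
  2:{ rewrite N_eq, k_eq; apply evn_mul; [apply evn_const; lia| |rewrite <- k_eq, <- N_eq; lia].
      apply evn_var; [reflexivity|lia]. }
  rewrite (exec_assign w 5 _ M).
  2:{ rewrite M_eq; apply evn_mul; [apply evn_var; [reflexivity|lia]| |rewrite <- M_eq; lia].
      apply evn_var; [exact (Hv 0 ltac:(cbn [length]; lia))|lia]. }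
  rewrite (exec_assign w 6 _ 1) by (apply evn_const; lia).
  rewrite exec_block_nil; cbn [fst snd]; split; [vars_tac|reflexivity].
Qed.

Lemma power_correct s :
  vars_are [n; m; A; B; N; M; 1] s ->
  let s' := fun j => Nat.iter j (exec_block w power_body) s in
  let J := S (Nat.log2 N) in
  let e := EOp OLt vp (EOp OAdd vN (EConst 1)) in
  (forall j, j < J -> ev w (s' j) e <> 0%Z) /\ ev w (s' J) e = 0%Z /\
  vars_are [n; m; A; B; N; M; p] (s' J) /\ snd (s' J) = snd s.
Proof.
  facts; intros Hs s' J e.
  assert (I : forall j, j <= J ->
    vars_are [n; m; A; B; N; M; 2 ^ j] (s' j) /\ snd (s' j) = snd s).
  { apply (iter_invariant _ (fun j s1 => vars_are [n; m; A; B; N; M; 2 ^ j] s1 /\ snd s1 = snd s));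
      [auto|].
    intros j [v mm] Hj [Hv Hm].
    assert (Hpow : 2 ^ S j <= p) by (rewrite p_eq; apply Nat.pow_le_mono_r; lia).
    rewrite Nat.pow_succ_r' in Hpow |- *; unfold power_body.
    rewrite (exec_assign w 6 _ (2 ^ j + 2 ^ j)) by (repeat evn_step Hv; lia).
    replace (2 * 2 ^ j) with (2 ^ j + 2 ^ j) by lia.
    split; [rewrite exec_block_nil; cbn [fst snd]; vars_tac|exact Hm]. }
  assert (V : forall j, j <= J -> evn w (s' j) e (if 2 ^ j <? N + 1 then 1 else 0)).
  { intros j Hj; destruct (I j Hj) as [Hv _]; unfold e.
    assert (Hpow : 2 ^ j <= p) by (rewrite p_eq; apply Nat.pow_le_mono_r; lia).
    repeat evn_step Hv; lia. }
  split; [|split].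
  - intros j Hj; destruct (V j ltac:(lia)) as [-> _].
    assert (2 ^ j <= 2 ^ Nat.log2 N) by (apply Nat.pow_le_mono_r; lia).
    destruct (Nat.log2_spec N ltac:(lia)) as [L1 _].
    rewrite (proj2 (Nat.ltb_lt _ _)) by lia; discriminate.
  - destruct (V J (Nat.le_refl J)) as [-> _]; unfold J; rewrite <- p_eq.
    rewrite (proj2 (Nat.ltb_ge _ _)) by lia; reflexivity.
  - rewrite p_eq; apply (I J); lia.
Qed.

Lemma constants_correct s :
  vars_are [n; m; A; B; N; M; p] s ->
  let s' := exec_block w (constants_block C D) s in
  vars_are (consts ++ [0]) s' /\ snd s' = snd s.
Proof.
  facts; intros Hs; cbv zeta; unfold constants_block.
  rewrite !exec_block_app, !exec_repeat_block.
  destruct s as [v0 m0]; cbn [snd].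
  rewrite (exec_assign w 7 _ 1) by (apply evn_const; lia); cbn [fst snd].
  rewrite exec_block_nil; set (s1 := (_, m0) : env).
  assert (I : vars_are [n; m; A; B; N; M; p; p ^ C]
      (Nat.iter C (exec_block w [SAssign 7 (EOp OMul vmask vp)]) s1) /\
    snd (Nat.iter C (exec_block w [SAssign 7 (EOp OMul vmask vp)]) s1) = m0).
  { apply (iter_invariant _ (fun j s => vars_are [n; m; A; B; N; M; p; p ^ j] s /\ snd s = m0) _ C);
      [| |lia].
    - split; [unfold s1; vars_tac|reflexivity].
    - intros j [v mm] Hj [Hv Hm].
      assert (Hpow : p ^ S j <= hC) by (rewrite hC_eq; apply Nat.pow_le_mono_r; lia).
      assert (Hpow' : p ^ j <= hC) by (rewrite hC_eq; apply Nat.pow_le_mono_r; lia).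
      rewrite Nat.pow_succ_r', Nat.mul_comm in Hpow |- *.
      rewrite (exec_assign w 7 _ (p ^ j * p)) by (repeat evn_step Hv; lia).
      split; [rewrite exec_block_nil; cbn [fst snd]; vars_tac|exact Hm]. }
  destruct (Nat.iter C _ s1) as [v mm]; destruct I as [Hv Hm]; cbn [snd] in Hm; subst mm.
  rewrite <- hC_eq in Hv.
  assert (HhC : hC * p <= hC * p * p /\ hC * p * p <= H)
    by (clear - F2 H_eq; rewrite H_eq; generalize (hC * p); intros; split; nia).
  rewrite (exec_assign w 8 _ H)
    by (rewrite H_eq; repeat evn_step Hv; try rewrite <- H_eq; lia).
  cbn [fst snd].
  rewrite (exec_assign w 7 _ (hC - 1)).
  2:{ apply evn_sub; [|apply evn_const; lia|lia].
      apply evn_var; [exact (Hv 7 ltac:(cbn [length]; lia))|lia]. }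
  cbn [fst snd].
  assert (Hpp : p * p <= big) by (clear - big_eq F18; rewrite big_eq; nia).
  rewrite (exec_assign w 9 _ (p * p)).
  2:{ apply evn_mul; [| |lia]; (apply evn_var; [exact (Hv 6 ltac:(cbn [length]; lia))|lia]). }
  rewrite exec_block_nil; cbn [fst snd].
  set (s2 := (_, m0) : env).
  assert (Hv2 : vars_are [n; m; A; B; N; M; p; hC - 1; H] s2) by (unfold s2; vars_tac).
  assert (I : vars_are [n; m; A; B; N; M; p; hC - 1; H; p * p * p ^ D]
      (Nat.iter D (exec_block w [SAssign 9 (EOp OMul vbig vp)]) s2) /\
    snd (Nat.iter D (exec_block w [SAssign 9 (EOp OMul vbig vp)]) s2) = m0).
  { apply (iter_invariant _ (fun j s =>
      vars_are [n; m; A; B; N; M; p; hC - 1; H; p * p * p ^ j] s /\ snd s = m0) _ D); [| |lia].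
    - split; [|reflexivity]; rewrite Nat.mul_1_r; unfold s2 in *; vars_tac.
    - intros j [v' mm] Hj [Hv' Hm].
      assert (Hpow : p * p * p ^ S j <= big)
        by (rewrite big_eq; apply Nat.mul_le_mono_l, Nat.pow_le_mono_r; lia).
      assert (Hpow' : p * p * p ^ j <= big)
        by (rewrite big_eq; apply Nat.mul_le_mono_l, Nat.pow_le_mono_r; lia).
      replace (p * p * p ^ S j) with (p * p * p ^ j * p) in * by (rewrite Nat.pow_succ_r'; ring).
      clear Hv Hv2 Hs.
      rewrite (exec_assign w 9 _ (p * p * p ^ j * p)) by (repeat evn_step Hv'; lia).
      split; [rewrite exec_block_nil; cbn [fst snd]; vars_tac|exact Hm]. }
  destruct (Nat.iter D _ s2) as [v' mm]; destruct I as [Hv' Hm]; cbn [snd] in Hm; subst mm.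
  rewrite <- big_eq in Hv'; clear Hv Hv2 Hs.
  assert (Hsh : big * p <= big * p * p /\ big * p * p <= shift)
    by (clear - F2 shift_eq; rewrite shift_eq; generalize (big * p); intros; split; nia).
  rewrite (exec_assign w 10 _ shift)
    by (rewrite shift_eq; repeat evn_step Hv'; try rewrite <- shift_eq; lia).
  cbn [fst snd].
  rewrite (exec_assign w 11 _ 0) by (apply evn_const; lia).
  rewrite exec_block_nil; cbn [fst snd]; unfold consts; cbn [app]; split; [vars_tac|reflexivity].
Qed.

Definition matrix_holds (G0 : wgraph) (f : Z -> Z) : Prop :=
  forall u v, u < n -> v < n -> f (Z.of_nat (H + u * n + v)) = Z.of_nat (wt G0 u v).

Lemma matrix_step j s :
  j < m ->
  vars_are (consts ++ [j]) s /\ (forall a, a < H -> snd s (Z.of_nat a) = mem0 (Z.of_nat a)) /\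
    matrix_holds (WGraph n (firstn j (edges G))) (snd s) ->
  let s' := exec_block w matrix_body s in
  vars_are (consts ++ [S j]) s' /\ (forall a, a < H -> snd s' (Z.of_nat a) = mem0 (Z.of_nat a)) /\
    matrix_holds (WGraph n (firstn (S j) (edges G))) (snd s').
Proof.
  facts; destruct s as [vv mm]; intros Hj (Hv & Hm & Hmx); cbn [snd] in *.
  destruct (nth j (edges G) (0, 0, 0%Z)) as [[u v] x] eqn:E.
  assert (Hi : In (u, v, x) (edges G))
    by (rewrite <- E; apply nth_In; rewrite m_eq in Hj; exact Hj).
  destruct (proj1 HG _ _ _ Hi) as [Huv Hvn]; rewrite <- n_eq in Hvn.
  pose proof (HW _ _ _ Hi) as Hx.
  assert (Hxn : x = Z.of_nat (Z.to_nat x)) by lia.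
  destruct (nth_encode G j u v x _ ltac:(lia) E) as (E1 & E2 & E3).
  assert (Hj3 : 3 * j + 4 < H) by lia.
  assert (C1 : mm (Z.of_nat (3 * j + 2)) = Z.of_nat u)
    by (rewrite Hm, mem0_at, E1 by lia; apply wrap_of_nat_small; lia).
  assert (C2 : mm (Z.of_nat (3 * j + 3)) = Z.of_nat v)
    by (rewrite Hm, mem0_at, E2 by lia; apply wrap_of_nat_small; lia).
  assert (C3 : mm (Z.of_nat (3 * j + 4)) = Z.of_nat (Z.to_nat x))
    by (rewrite Hm, mem0_at, E3, Hxn by lia; rewrite Nat2Z.id; apply wrap_of_nat_small; lia).
  assert (Hun : u * n + v < n * n) by (clear - Huv Hvn; nia).
  assert (Hvn' : v * n + u < n * n) by (clear - Huv Hvn; nia).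
  cbv zeta; unfold matrix_body.
  rewrite (exec_assign w 12 _ u)
    by (apply (evn_load _ _ _ (3 * j + 2)); [repeat evn_step Hv; lia|exact C1|lia]).
  cbn [fst snd].
  apply (vars_are_set _ _ _ 12 (Z.of_nat u) mm) in Hv; [|cbn [consts app length]; lia].
  rewrite (exec_assign w 13 _ v)
    by (apply (evn_load _ _ _ (3 * j + 3)); [repeat evn_step Hv; lia|exact C2|lia]).
  cbn [fst snd].
  apply (vars_are_set _ _ _ 13 (Z.of_nat v) mm) in Hv; [|cbn [consts app length]; lia].
  rewrite (exec_assign w 14 _ (Z.to_nat x))
    by (apply (evn_load _ _ _ (3 * j + 4)); [repeat evn_step Hv; lia|exact C3|lia]).
  cbn [fst snd].
  apply (vars_are_set _ _ _ 14 (Z.of_nat (Z.to_nat x)) mm) in Hv; [|cbn [consts app length]; lia].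
  rewrite (exec_store w _ _ (H + u * n + v) (Z.to_nat x)) by (repeat evn_step Hv; lia).
  cbn [fst snd].
  set (m1 := set_mem mm _ _).
  apply (vars_are_mem _ _ _ m1) in Hv.
  rewrite (exec_store w _ _ (H + v * n + u) (Z.to_nat x)) by (repeat evn_step Hv; lia).
  cbn [fst snd].
  set (m2 := set_mem m1 _ _).
  apply (vars_are_mem _ _ _ m2) in Hv.
  rewrite (exec_assign w 11 _ (j + 1)) by (repeat evn_step Hv; lia).
  rewrite (Nat.add_1_r j), exec_block_nil; cbn [fst snd]; split; [|split].
  - unfold consts in *; cbn [app] in *; vars_tac.
  - intros a Ha; unfold m2, m1; rewrite !set_mem_neq by lia; auto.
  - intros a b Ha Hb.
    rewrite n_eq, (wt_firstn G j u v x _ a b HG ltac:(lia) E), <- n_eq.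
    unfold m2, m1, set_mem.
    pose proof (index_inj n a b u v Hb Hvn) as I1.
    pose proof (index_inj n a b v u Hb ltac:(lia)) as I2.
    destruct (Z.eqb_spec (Z.of_nat (H + a * n + b)) (Z.of_nat (H + v * n + u))) as [Q|Q].
    + destruct I2 as [-> ->]; [lia|]; rewrite !Nat.eqb_refl, Bool.orb_true_r; reflexivity.
    + destruct (Z.eqb_spec (Z.of_nat (H + a * n + b)) (Z.of_nat (H + u * n + v))) as [Q'|Q'].
      * destruct I1 as [-> ->]; [lia|]; rewrite !Nat.eqb_refl; reflexivity.
      * rewrite Hmx by assumption.
        destruct (Nat.eqb_spec a u), (Nat.eqb_spec b v), (Nat.eqb_spec a v), (Nat.eqb_spec b u);
          cbn; try reflexivity; exfalso; subst; auto.
Qed.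

Lemma counter_test s j x e :
  vars_are (consts ++ [j]) s -> evn w s e x -> j < 2 ^ w -> 
  evn w s (EOp OLt ve e) (if j <? x then 1 else 0).
Proof.
  facts; intros Hv He Hj; apply evn_lt; [|exact He|lia].
  unfold consts in Hv; cbn [app] in Hv; repeat evn_step Hv; lia.
Qed.

Lemma counter_loop (Inv : nat -> env -> Prop) (b : list stm) (i J : nat) s :
  J < 2 ^ w -> i < 11 -> nth i consts 0 = J ->
  (forall j s, Inv j s -> vars_are (consts ++ [j]) s) ->
  Inv 0 s -> (forall j s, j < J -> Inv j s -> Inv (S j) (exec_block w b s)) ->
  let s' := fun j => Nat.iter j (exec_block w b) s in
  (forall j, j < J -> ev w (s' j) (EOp OLt ve (EVar i)) <> 0%Z) /\
  ev w (s' J) (EOp OLt ve (EVar i)) = 0%Z /\ Inv J (s' J).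
Proof.
  intros HJ Hi EJ HI H0 HS s'.
  assert (I : forall j, j <= J -> Inv j (s' j)) by (apply iter_invariant; assumption).
  assert (V : forall j, j <= J ->
    evn w (s' j) (EOp OLt ve (EVar i)) (if j <? J then 1 else 0)).
  { intros j Hj; pose proof (HI _ _ (I j Hj)) as Hv; apply counter_test; [exact Hv| |lia].
    apply (vars_are_var _ _ _ _ _ Hv); [rewrite length_app; cbn [consts length]; lia| |exact HJ].
    rewrite app_nth1 by exact Hi; exact EJ. }
  split; [|split; [|apply I; lia]].
  - intros j Hj; destruct (V j ltac:(lia)) as [-> _].
    rewrite (proj2 (Nat.ltb_lt _ _)) by exact Hj; discriminate.
  - destruct (V J (Nat.le_refl J)) as [-> _]; rewrite Nat.ltb_irrefl; reflexivity.
Qed.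

(** Below the frontier the cells hold the new graph in short words, above it still the old input in
    long words. *)
Definition arcs_written (j : nat) (f : Z -> Z) : Prop :=
  forall a, a < H -> f (Z.of_nat a) =
    if a <? 2 + 3 * j then wrap w' (nth a (encode G') 0%Z) else wrap w (nth a (encode G) 0%Z).

Lemma header_correct s :
  vars_are (consts ++ [m]) s -> (forall a, a < H -> snd s (Z.of_nat a) = mem0 (Z.of_nat a)) ->
  matrix_holds G (snd s) ->
  let s' := exec_block w header_block s in
  vars_are (consts ++ [0]) s' /\ arcs_written 0 (snd s') /\ matrix_holds G (snd s').
Proof.
  facts; destruct s as [vv mm]; intros Hv Hm Hmx; cbn [snd] in *; cbv zeta; unfold header_block.
  unfold consts in *; cbn [app] in *.
  assert (Vmask : forall mm', evn w (vv, mm') vmask (2 ^ w' - 1)).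
  { intros; rewrite <- w'_eq; apply (vars_are_mem _ _ _ mm') in Hv; repeat evn_step Hv; lia. }
  rewrite (exec_store w _ _ 0 (N mod 2 ^ w'))
    by (first [apply evn_mask; [|apply Vmask]; repeat evn_step Hv; lia|apply evn_const; lia]).
  cbn [fst snd].
  set (m1 := set_mem mm _ _).
  apply (vars_are_mem _ _ _ m1) in Hv.
  rewrite (exec_store w _ _ 1 (M mod 2 ^ w'))
    by (first [apply evn_mask; [|apply Vmask]; repeat evn_step Hv; lia|apply evn_const; lia]).
  cbn [fst snd].
  set (m2 := set_mem m1 _ _).
  apply (vars_are_mem _ _ _ m2) in Hv.
  rewrite (exec_assign w 11 _ 0) by (apply evn_const; lia).
  rewrite exec_block_nil; cbn [fst snd]; split; [vars_tac|split].
  - intros a Ha; unfold m2, m1.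
    destruct a as [|[|a]].
    + rewrite set_mem_neq, set_mem_eq by lia.
      change (nth 0 (encode G') 0%Z) with (Z.of_nat (order G')).
      rewrite (proj2 (Nat.ltb_lt _ _)), wrap_of_nat by lia; do 2 f_equal.
      unfold G'; cbn [order layered]; rewrite N_eq, B_eq', A_eq, k_eq, Nat.pow_succ_r'; ring.
    + rewrite set_mem_eq by lia.
      change (nth 1 (encode G') 0%Z) with (Z.of_nat (num_edges G')).
      rewrite (proj2 (Nat.ltb_lt _ _)), wrap_of_nat by lia; do 2 f_equal.
      unfold G', num_edges; cbn [edges layered]; rewrite length_map, length_seq.
      rewrite M_eq, N_eq, B_eq', A_eq, k_eq, !Nat.pow_succ_r'; ring.
    + rewrite (proj2 (Nat.ltb_ge _ _)), !set_mem_neq, Hm, mem0_at by lia; reflexivity.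
  - intros u v Hu Hv'; unfold m2, m1; rewrite !set_mem_neq by lia; auto.
Qed.

Lemma pow_B : n ^ S q = B.
Proof. rewrite Nat.pow_succ_r', B_eq', A_eq; ring. Qed.

Lemma pow_Bn : n ^ S (S q) = B * n.
Proof. rewrite Nat.pow_succ_r', pow_B; ring. Qed.

Lemma M_kBn : M = k * (B * n).
Proof. rewrite M_eq, N_eq; ring. Qed.

Lemma cost_bound u v : cost u v <= big.
Proof.
  facts; apply (cost_le G W HW big q); rewrite <- k_eq; exact U10.
Qed.

Lemma digits_correct v0 mm j i z y u0 :
  y < B -> u0 < n -> z < 2 ^ w -> i < 2 ^ w -> j < 2 ^ w ->
  matrix_holds G mm ->
  vars_are (consts ++ [j; i; z; y; H + u0 * n; shift]) (v0, mm) ->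
  let s' := exec_block w (repeat_block (S q) digit_body) (v0, mm) in
  vars_are (consts ++ [j; i; z; y / n ^ S q; H + u0 * n;
    shift + sum_n (S q) (fun t => cost u0 (digit n t y))]) s' /\ snd s' = mm.
Proof.
  facts; intros Hy Hu Hz Hi Hj Hmx Hs; cbv zeta; rewrite exec_repeat_block.
  apply (iter_invariant _ (fun t s => vars_are (consts ++ [j; i; z; y / n ^ t; H + u0 * n;
    shift + sum_n t (fun t => cost u0 (digit n t y))]) s /\ snd s = mm) _ (S q)); [| |lia].
  - split; [|reflexivity]; cbn [Nat.pow sum_n]; rewrite Nat.div_1_r, Nat.add_0_r; exact Hs.
  - clear Hs; intros t [vv mm'] Ht [Hv Hm]; cbn [snd] in Hm; subst mm'.
    unfold consts in *; cbn [app] in *.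
    pose proof (div_le_self y (n ^ t)) as Hyt.
    set (dg := (y / n ^ t) mod n).
    assert (Hdg : dg < n) by (apply Nat.mod_upper_bound; lia).
    assert (Hacc : sum_n (S t) (fun t => cost u0 (digit n t y)) <= k * big).
    { apply Nat.le_trans with (S t * big); [apply sum_n_le; intros; apply cost_bound|].
      apply Nat.mul_le_mono_r; lia. }
    cbn [sum_n] in Hacc |- *; change (digit n t y) with dg in Hacc |- *.
    assert (Hidx : H + u0 * n + dg < H + n * n) by (clear - Hu Hdg; nia).
    pose proof (wt_le G W HW u0 dg) as Hwt.
    unfold digit_body.
    rewrite (exec_assign w 17 _ (wt G u0 dg)).
    2:{ apply (evn_load _ _ _ (H + u0 * n + dg)); [|apply Hmx; assumption|lia].
        unfold dg; repeat evn_step Hv; lia. }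
    cbn [fst snd].
    apply (vars_are_set _ _ _ 17 (Z.of_nat (wt G u0 dg)) mm) in Hv; [|cbn [length]; lia].
    assert (Ecost : cost u0 dg = wt G u0 dg + (if wt G u0 dg =? 0 then 1 else 0) * big).
    { unfold cost, clique_cost; destruct (wt G u0 dg =? 0); lia. }
    rewrite (exec_assign w 16 _ (shift + sum_n t (fun t => cost u0 (digit n t y)) + cost u0 dg)).
    2:{ rewrite Ecost in Hacc |- *; repeat evn_step Hv; try lia.
        all: destruct (wt G u0 dg =? 0); lia. }
    cbn [fst snd].
    rewrite (exec_assign w 14 _ (y / n ^ t / n)).
    2:{ apply evn_div; (apply evn_var; [|lia]).
        - exact (Hv 14 ltac:(cbn [length]; lia)).
        - exact (Hv 0 ltac:(cbn [length]; lia)). }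
    rewrite exec_block_nil; cbn [fst snd]; split; [|reflexivity].
    rewrite Nat.Div0.div_div, (Nat.mul_comm (n ^ t)), <- Nat.pow_succ_r', Nat.add_assoc.
    vars_tac.
Qed.

Lemma arc_step j s :
  j < M ->
  vars_are (consts ++ [j]) s /\ arcs_written j (snd s) /\ matrix_holds G (snd s) ->
  let s' := exec_block w (arc_body q) s in
  vars_are (consts ++ [S j]) s' /\ arcs_written (S j) (snd s') /\ matrix_holds G (snd s').
Proof.
  facts; destruct s as [vv mm]; intros Hj (Hv & Hm & Hmx); cbn [snd] in *.
  pose proof M_kBn as EM; pose proof pow_B as EB; pose proof pow_Bn as EBn.
  (* Layer, window, target tuple, and the leading digit of the source tuple [z / n], which is the
     vertex whose l edges this arc pays for. *)
  set (i := j / (B * n)); set (z := j mod (B * n)); set (y := z mod B); set (u0 := z / n / A).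
  assert (HBn : 0 < B * n) by (clear - Hn F4 F5; nia).
  destruct (larc_parts n q Hn j) as (P1 & P2 & P3 & P4 & P5 & P6);
    [rewrite EB, <- k_eq; lia|].
  rewrite EB in P1, P2, P3, P4, P5, P6; rewrite <- k_eq in P3, P5.
  fold i in P1, P3, P5; fold z in P2, P4, P6; fold y in P4.
  assert (Hz : z < B * n) by (apply Nat.mod_upper_bound; lia).
  assert (Hy : y < B) by (apply Nat.mod_upper_bound; lia).
  assert (Hu0 : u0 < n) by (apply Nat.Div0.div_lt_upper_bound; rewrite <- B_eq'; exact P6).
  assert (Hik : (i + 1) mod k < k) by (apply Nat.mod_upper_bound; lia).
  assert (Hfst : i * B + z / n < k * B) by (clear - P5 P6; nia).
  assert (Hsnd : (i + 1) mod k * B + y < k * B) by (clear - Hik Hy; nia).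
  rewrite <- N_eq in Hfst, Hsnd.
  assert (Ru : u0 * n < n * n) by (clear - Hu0; nia).
  assert (EL : larc n q j = (i * B + z / n, (i + 1) mod k * B + y)).
  { unfold larc; rewrite EB, EBn, <- k_eq; fold i z y; now rewrite Nat.add_1_r. }
  set (wgt := shift + sum_n (S q) (fun t => cost u0 (digit n t y))).
  assert (Hwgt : wgt < 2 ^ w).
  { assert (sum_n (S q) (fun t => cost u0 (digit n t y)) <= k * big); [|unfold wgt; lia].
    apply Nat.le_trans with (S q * big); [apply sum_n_le; intros; apply cost_bound|].
    apply Nat.mul_le_mono_r; lia. }
  assert (EW : lweight n q shift cost (fst (larc n q j)) (snd (larc n q j)) = wgt).
  { unfold lweight, top, wgt; rewrite EB, P2, P4, <- A_eq; reflexivity. }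
  destruct (nth_encode G' j (i * B + z / n) ((i + 1) mod k * B + y) (Z.of_nat wgt) (0, 0, 0%Z))
    as (N1 & N2 & N3).
  { unfold G', num_edges; cbn [edges layered]; rewrite length_map, length_seq, EBn, <- k_eq; lia. }
  { unfold G'; cbn [edges layered]; rewrite nth_map_seq by (rewrite EBn, <- k_eq; lia).
    rewrite EW, EL; reflexivity. }
  cbv zeta; unfold arc_body; rewrite exec_block_app.
  unfold consts in *; cbn [app] in *.
  rewrite (exec_assign w 12 _ i) by (unfold i; repeat evn_step Hv; lia).
  cbn [fst snd].
  apply (vars_are_set _ _ _ 12 (Z.of_nat i) mm) in Hv; [|cbn [length]; lia].
  rewrite (exec_assign w 13 _ z) by (unfold z; repeat evn_step Hv; lia).
  cbn [fst snd].
  apply (vars_are_set _ _ _ 13 (Z.of_nat z) mm) in Hv; [|cbn [length]; lia].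
  rewrite (exec_assign w 14 _ y) by (unfold y; repeat evn_step Hv; lia).
  cbn [fst snd].
  apply (vars_are_set _ _ _ 14 (Z.of_nat y) mm) in Hv; [|cbn [length]; lia].
  assert (Vmask : forall v' mm', vars_are [n; m; A; B; N; M; p; hC - 1; H; big; shift; j] (v', mm') ->
    evn w (v', mm') vmask (2 ^ w' - 1)).
  { intros v' mm' Hv'; rewrite <- w'_eq; repeat evn_step Hv'; lia. }
  rewrite (exec_store w _ _ (3 * j + 2) ((i * B + z / n) mod 2 ^ w')).
  2:{ repeat evn_step Hv; lia. }
  2:{ apply evn_mask; [|now apply Vmask]; repeat evn_step Hv; lia. }
  cbn [fst snd].
  set (m1 := set_mem mm _ _).
  apply (vars_are_mem _ _ _ m1) in Hv.
  rewrite (exec_store w _ _ (3 * j + 3) (((i + 1) mod k * B + y) mod 2 ^ w')).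
  2:{ repeat evn_step Hv; lia. }
  2:{ apply evn_mask; [|now apply Vmask]; rewrite <- k_eq; repeat evn_step Hv; lia. }
  cbn [fst snd].
  set (m2 := set_mem m1 _ _).
  apply (vars_are_mem _ _ _ m2) in Hv.
  rewrite (exec_assign w 15 _ (H + u0 * n)) by (unfold u0; repeat evn_step Hv; fold u0; lia).
  cbn [fst snd].
  apply (vars_are_set _ _ _ 15 (Z.of_nat (H + u0 * n)) m2) in Hv; [|cbn [length]; lia].
  rewrite (exec_assign w 16 _ shift) by (repeat evn_step Hv; lia).
  rewrite exec_block_nil, exec_block_app; cbn [fst snd].
  assert (Hlow : forall a, H <= a -> m2 (Z.of_nat a) = mm (Z.of_nat a))
    by (intros; unfold m2, m1; rewrite !set_mem_neq by lia; reflexivity).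
  match goal with |- context [exec_block w (repeat_block _ _) (?v', m2)] =>
    destruct (digits_correct v' m2 j i z y u0) as [Hv3 Hm3]; auto; try lia end.
  { intros a b Ha Hb; rewrite Hlow by lia; now apply Hmx. }
  { unfold consts; cbn [app]; vars_tac. }
  destruct (exec_block w (repeat_block (S q) digit_body) _) as [v3 m3].
  cbn [snd] in Hm3; subst m3; unfold consts in Hv3; cbn [app] in Hv3; fold wgt in Hv3.
  clear Hv.
  rewrite (exec_store w _ _ (3 * j + 4) (wgt mod 2 ^ w')).
  2:{ repeat evn_step Hv3; lia. }
  2:{ apply evn_mask; [repeat evn_step Hv3; lia|].
      rewrite <- w'_eq; repeat evn_step Hv3; lia. }
  cbn [fst snd].
  set (m3 := set_mem m2 _ _).
  apply (vars_are_mem _ _ _ m3) in Hv3.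
  rewrite (exec_assign w 11 _ (j + 1)) by (repeat evn_step Hv3; lia).
  rewrite (Nat.add_1_r j), exec_block_nil; cbn [fst snd]; split; [vars_tac|split].
  - intros a Ha; unfold m3, m2, m1.
    destruct (Nat.eq_dec a (3 * j + 4)) as [->|D4].
    { rewrite set_mem_eq, (proj2 (Nat.ltb_lt _ _)), N3, wrap_of_nat by lia; reflexivity. }
    destruct (Nat.eq_dec a (3 * j + 3)) as [->|D3].
    { rewrite set_mem_neq, set_mem_eq, (proj2 (Nat.ltb_lt _ _)), N2, wrap_of_nat by lia.
      reflexivity. }
    destruct (Nat.eq_dec a (3 * j + 2)) as [->|D2].
    { rewrite !set_mem_neq, set_mem_eq, (proj2 (Nat.ltb_lt _ _)), N1, wrap_of_nat by lia.
      reflexivity. }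
    rewrite !set_mem_neq, Hm by lia.
    destruct (Nat.ltb_spec a (2 + 3 * j)), (Nat.ltb_spec a (2 + 3 * S j)); auto; lia.
  - intros a b Ha Hb; unfold m3; rewrite set_mem_neq, Hlow by lia; now apply Hmx.
Qed.

(** Shaped like the time index of [exec_segs] on [build_segs], down to the final 0, so that its
    constructors apply directly. *)
Definition build_time : nat :=
  length (compile_block (sizes_block q)) +
  (S (Nat.log2 N) * loop_size (EOp OLt vp (EOp OAdd vN (EConst 1))) power_body +
   loop_size (EOp OLt vp (EOp OAdd vN (EConst 1))) power_body +
  (length (compile_block (constants_block C D)) +
  (m * loop_size (EOp OLt ve vm) matrix_body + loop_size (EOp OLt ve vm) matrix_body +
  (length (compile_block header_block) +
  (M * loop_size (EOp OLt ve vM) (arc_body q) + loop_size (EOp OLt ve vM) (arc_body q) + 0))))).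

Lemma build_correct : exists s',
  exec_segs w (build_segs q C D) (fun _ => 0%Z, mem0) s' build_time /\
  vars_are consts s' /\
  (forall a, a < H -> snd s' (Z.of_nat a) = wrap w' (nth a (encode G') 0%Z)) /\
  matrix_holds G (snd s').
Proof.
  facts.
  destruct sizes_correct as [V1 M1]; set (s1 := exec_block w (sizes_block q) _) in *.
  destruct (power_correct s1 V1) as (T2 & T2' & V2 & M2).
  set (s2 := Nat.iter (S (Nat.log2 N)) (exec_block w power_body) s1) in *.
  destruct (constants_correct s2 V2) as [V3 M3].
  set (s3 := exec_block w (constants_block C D) s2) in *.
  assert (M3' : snd s3 = mem0) by congruence.
  destruct (counter_loop (fun j s => vars_are (consts ++ [j]) s /\
    (forall a, a < H -> snd s (Z.of_nat a) = mem0 (Z.of_nat a)) /\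
    matrix_holds (WGraph n (firstn j (edges G))) (snd s)) matrix_body 1 m s3)
    as (T4 & T4' & V4 & M4 & X4).
  - lia.
  - lia.
  - reflexivity.
  - intros j s Hs; apply Hs.
  - split; [exact V3|]; rewrite M3'; split; [auto|].
    (* The cells from H on lie beyond the input and start as zeros, which is already the matrix of
       the edgeless graph. *)
    intros u v Hu Hv.
    change (Z.of_nat (wt (WGraph n (firstn 0 (edges G))) u v)) with 0%Z.
    rewrite mem0_at, nth_overflow; [reflexivity|rewrite length_encode, <- m_eq; lia].
  - intros j s Hj Hs; now apply matrix_step.
  - set (s4 := Nat.iter m (exec_block w matrix_body) s3) in *.
    assert (EG : WGraph n (firstn m (edges G)) = G).
    { rewrite m_eq, n_eq; unfold num_edges; rewrite firstn_all; now destruct G. }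
    rewrite EG in X4.
    destruct (header_correct s4 V4 M4 X4) as (V5 & M5 & X5).
    set (s5 := exec_block w header_block s4) in *.
    destruct (counter_loop (fun j s => vars_are (consts ++ [j]) s /\ arcs_written j (snd s) /\
      matrix_holds G (snd s)) (arc_body q) 5 M s5) as (T6 & T6' & V6 & M6 & X6).
    + lia.
    + lia.
    + reflexivity.
    + intros j s Hs; apply Hs.
    + auto.
    + intros j s Hj Hs; now apply arc_step.
    + set (s6 := Nat.iter M (exec_block w (arc_body q)) s5) in *.
      exists s6; split; [|split; [|split]].
      * unfold build_segs, build_time; apply exec_Block, exec_Loop; [exact T2|exact T2'|].
        apply exec_Block, exec_Loop; [exact T4|exact T4'|].
        apply exec_Block, exec_Loop; [exact T6|exact T6'|]; apply exec_nil.
      * intros x Hx; rewrite (V6 x) by (rewrite length_app; lia).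
        now rewrite app_nth1.
      * intros a Ha; rewrite M6 by exact Ha.
        destruct (Nat.ltb_spec a (2 + 3 * M)) as [L|L]; [reflexivity|].
        (* The old input is no longer than the new encoding, as m <= n^2 <= M. So nothing of it
           remains, and the simulated machine sees zeros after its input. *)
        rewrite !nth_overflow; [unfold wrap; now rewrite !Zmod_0_l| |].
        -- rewrite length_encode; unfold G', num_edges; cbn [edges layered].
           rewrite length_map, length_seq, pow_Bn, <- k_eq, <- M_kBn; exact L.
        -- rewrite length_encode, <- m_eq; lia.
      * exact X6.
Qed.

(** * Decoding the cycle and testing for a clique *)

Section Decode.

Variable cyc : list nat.
Hypothesis cyc_len : length cyc = k.
Hypothesis cyc_lt : forall i, i < k -> nth i cyc 0 < 2 ^ w.

Let r := map (top n q) cyc.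

Lemma nth_r i : i < k -> nth i r 0 = (nth i cyc 0 mod B) / A.
Proof.
  intros Hi; unfold r; rewrite (nth_indep _ 0 (top n q 0)) by (rewrite length_map; lia).
  rewrite map_nth; unfold top; now rewrite pow_B, <- A_eq.
Qed.

Lemma nth_r_lt i : i < k -> nth i r 0 < n.
Proof.
  facts; intros Hi; rewrite nth_r by exact Hi; apply Nat.Div0.div_lt_upper_bound.
  rewrite <- B_eq'; apply Nat.mod_upper_bound; lia.
Qed.

(** Decoding is in place: cells before position t already hold clique vertices, the later ones still
    cycle vertices. *)
Lemma decode_stage s t :
  vars_are consts s -> matrix_holds G (snd s) ->
  (forall i, i < k -> snd s (Z.of_nat (S i)) = Z.of_nat (nth i cyc 0)) -> t <= k ->
  let s' := exec_block w (map decode_stm (seq 1 t)) s in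
  vars_are consts s' /\ matrix_holds G (snd s') /\
  (forall i, i < k -> snd s' (Z.of_nat (S i)) = Z.of_nat (nth i (if i <? t then r else cyc) 0)).
Proof.
  facts; intros Hv Hmx Hc; cbv zeta; induction t as [|t IH]; intros Ht; [auto|].
  rewrite seq_S, map_app, exec_block_app.
  destruct (IH ltac:(lia)) as (V & X & E); destruct (exec_block w _ s) as [vv mm].
  cbn [map snd] in *; unfold decode_stm; change (1 + t) with (S t).
  pose proof (E t ltac:(lia)) as Et; rewrite Nat.ltb_irrefl in Et.
  unfold consts in *.
  rewrite (exec_store w _ _ (S t) (nth t r 0)).
  2:{ apply evn_const; lia. }
  2:{ rewrite nth_r by lia; apply evn_div; [apply evn_mod|].
      - apply (evn_load _ _ _ (S t)); [apply evn_const; lia|exact Et|apply cyc_lt; lia].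
      - repeat evn_step V; lia.
      - repeat evn_step V; lia. }
  rewrite exec_block_nil; cbn [fst snd]; split; [exact V|split].
  - intros u v Hu Hv'; rewrite set_mem_neq by lia; auto.
  - intros i Hi; destruct (Nat.eq_dec i t) as [->|Hit].
    + rewrite set_mem_eq, (proj2 (Nat.ltb_lt _ _)) by lia; reflexivity.
    + rewrite set_mem_neq, E by lia.
      destruct (Nat.ltb_spec i t), (Nat.ltb_spec i (S t)); auto; lia.
Qed.

Lemma check_stage s ps (b : bool) :
  vars_are (consts ++ [if b then 1 else 0]) s -> matrix_holds G (snd s) ->
  (forall i, i < k -> snd s (Z.of_nat (S i)) = Z.of_nat (nth i r 0)) ->
  (forall p, In p ps -> fst p < k /\ snd p < k) ->
  let b' := (b && forallb (fun p => negb (wt G (nth (fst p) r 0) (nth (snd p) r 0) =? 0)) ps)%bool in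
  let s' := exec_block w (map check_stm ps) s in
  vars_are (consts ++ [if b' then 1 else 0]) s' /\ snd s' = snd s.
Proof.
  facts; revert s b; induction ps as [|[a c] ps IH]; intros [vv mm] b Hv Hmx Hc Hps; cbv zeta.
  - cbn [forallb]; rewrite Bool.andb_true_r; auto.
  - cbn [map forallb fst snd] in *.
    destruct (Hps (a, c)) as [Ha Hb]; [now left|]; cbn [fst snd] in Ha, Hb.
    pose proof (nth_r_lt a Ha) as Ra; pose proof (nth_r_lt c Hb) as Rc.
    set (u := nth a r 0) in *; set (v := nth c r 0) in *.
    pose proof (wt_le G W HW u v) as Hwt.
    assert (Hidx : u * n + v < n * n) by (clear - Ra Rc; nia).
    unfold consts in *; cbn [app] in *.
    set (b1 := negb (wt G u v =? 0)).
    assert (Es : exec_block w (check_stm (a, c) :: map check_stm ps) (vv, mm) =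
      exec_block w (map check_stm ps) (set_reg vv 11
        (Z.of_nat ((if b then 1 else 0) * (if 0 <? wt G u v then 1 else 0))), mm)).
    { apply exec_assign; cbn [fst snd]; apply evn_mul.
        - repeat evn_step Hv; destruct b; lia.
        - apply evn_lt; [apply evn_const; lia| |lia].
          apply (evn_load _ _ _ (H + u * n + v)); [|apply Hmx; auto|lia].
          repeat evn_step Hv; try lia.
          + apply (evn_load _ _ _ (S a)); [apply evn_const; lia|apply Hc; exact Ha|lia].
          + apply (evn_load _ _ _ (S c)); [apply evn_const; lia|apply Hc; exact Hb|lia].
        - destruct b, (0 <? wt G u v); lia. }
    rewrite Es; clear Es.
    replace ((if b then 1 else 0) * (if 0 <? wt G u v then 1 else 0))
      with (if (b && b1)%bool then 1 else 0).
    2:{ unfold b1; destruct b, (Nat.ltb_spec 0 (wt G u v)), (Nat.eqb_spec (wt G u v) 0);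
          cbn; lia. }
    rewrite Bool.andb_assoc; fold b1.
    apply (IH (_, mm) (b && b1)%bool); [vars_tac|exact Hmx|exact Hc|].
    intros p' Hp'; apply Hps; now right.
Qed.

Lemma decode_correct s :
  vars_are consts s -> matrix_holds G (snd s) ->
  (forall i, i < k -> snd s (Z.of_nat (S i)) = Z.of_nat (nth i cyc 0)) ->
  let f := snd (exec_block w (decode_block q) s) in
  map (fun i => Z.to_nat (f (Z.of_nat i))) (seq 1 (Z.to_nat (f 0%Z))) = clique_answer G r.
Proof.
  facts; intros Hv Hmx Hc; cbv zeta; unfold decode_block; rewrite <- k_eq.
  rewrite exec_block_app.
  destruct (decode_stage s k Hv Hmx Hc (Nat.le_refl k)) as (V1 & X1 & E1).
  destruct (exec_block w (map decode_stm (seq 1 k)) s) as [v1 m1].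
  rewrite exec_block_app, (exec_assign w 11 _ 1), exec_block_nil by (apply evn_const; lia).
  cbn [fst snd] in *; rewrite exec_block_app.
  set (s2 := (_, m1) : env).
  destruct (check_stage s2 (index_pairs k) true) as [V3 M3].
  - unfold s2, consts in *; cbn [app]; vars_tac.
  - exact X1.
  - intros i Hi; cbn [snd s2]; rewrite E1 by exact Hi.
    now rewrite (proj2 (Nat.ltb_lt _ _)).
  - intros [a b] Hp; apply in_index_pairs in Hp; cbn [fst snd]; lia.
  - replace k with (length r) in V3 at 1 by (unfold r; rewrite length_map; exact cyc_len).
    cbn [andb] in V3; fold (all_adjacent G r) in V3.
    set (s3 := exec_block w (map check_stm (index_pairs k)) s2) in *.
    set (b := all_adjacent G r) in *.
    assert (Vk : evn w s3 (EOp OMul ve (EConst k)) ((if b then 1 else 0) * k)).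
    { unfold consts in V3; cbn [app] in V3.
      apply evn_mul; [|apply evn_const; lia|]; [repeat evn_step V3|]; destruct b; lia. }
    rewrite (exec_store w _ _ 0 ((if b then 1 else 0) * k)), exec_block_nil
      by (try exact Vk; apply evn_const; lia).
    cbn [snd]; rewrite M3; cbn [snd s2].
    set (m4 := set_mem m1 _ _).
    replace (m4 0%Z) with (Z.of_nat ((if b then 1 else 0) * k))
      by (symmetry; apply set_mem_eq).
    rewrite Nat2Z.id.
    unfold clique_answer; fold b; destruct b; [|reflexivity].
    rewrite Nat.mul_1_l; apply (nth_ext _ _ 0 0).
    + unfold r; now rewrite !length_map, length_seq.
    + intros i Hi; rewrite length_map, length_seq in Hi.
      rewrite <- seq_shift, map_map, nth_map_seq by exact Hi.
      unfold m4; rewrite set_mem_neq, E1, (proj2 (Nat.ltb_lt _ _)), Nat2Z.id by lia; reflexivity.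
Qed.

End Decode.

End Build.

(** * The complete reduction *)

Definition reduction_program (q C D : nat) (P : program) : program :=
  let build := compile_segs 0 (build_segs q C D) in
  build ++ translate (length build) (var_reg 7) P ++ compile_block (decode_block q).

Lemma code_at_mid (pre c post : list instr) : code_at (pre ++ c ++ post) (length pre) c.
Proof. exists pre, post; auto. Qed.

(** * The complete run: construction, simulation, decoding *)

Section Run.

Variables (G : wgraph) (q C D w : nat) (P : program).
Let n := order G.
Let k := 2 * S q + 1.
Let N := k * (n ^ q * n).
Let p := 2 ^ S (Nat.log2 N).
Let big := p * p * p ^ D.
Let shift := big * p * p * p.
Let w' := word_size C N.
Let G' := layered n q shift (clique_cost big G).

Hypothesis HG : is_ugraph G.
Hypothesis Hn : 1 <= n.
Hypothesis HW : forall u v x, In (u, v, x) (edges G) -> (1 <= x <= Z.of_nat (n ^ D))%Z.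
(** One exponent covering both needs: p^(C+4) for the matrix addresses and p^(D+6) for the
    weights. *)
Hypothesis Hw : p ^ (C + D + 6) <= 2 ^ w.

Lemma p_pos : 1 <= p.
Proof. unfold p; pose proof (Nat.pow_nonzero 2 (S (Nat.log2 N))); lia. Qed.

(** This exact equality is the reason for choosing p = 2^(1 + log2 N): a short word has C (1 + log2
    N) bits. *)
Lemma hC_pow : p ^ C = 2 ^ w'.
Proof. unfold p, w', word_size; rewrite <- Nat.pow_mul_r; f_equal; lia. Qed.

Lemma Hw_matrix : p ^ C * p * p * p * p <= 2 ^ w.
Proof.
  apply Nat.le_trans with (2 := Hw).
  replace (p ^ C * p * p * p * p) with (p ^ (C + 4)) by (rewrite Nat.pow_add_r; cbn; ring).
  apply Nat.pow_le_mono_r; pose proof p_pos; lia.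
Qed.

Lemma Hw_weights : big * p * p * p * p <= 2 ^ w.
Proof.
  apply Nat.le_trans with (2 := Hw); unfold big.
  replace (p * p * p ^ D * p * p * p * p) with (p ^ (D + 6)) by (rewrite Nat.pow_add_r; cbn; ring).
  apply Nat.pow_le_mono_r; pose proof p_pos; lia.
Qed.

Lemma w'_le_w : w' <= w.
Proof.
  apply (Nat.pow_le_mono_r_iff 2); [lia|]; rewrite <- hC_pow.
  apply Nat.le_trans with (2 := Hw), Nat.pow_le_mono_r; pose proof p_pos; lia.
Qed.

Lemma arithmetic_facts :
  3 <= N /\ p <= 2 * N /\ k * k * n ^ D < big /\ k * k * big < shift.
Proof.
  pose proof (size_facts G q C D w w' n (num_edges G) k (n ^ q) (n ^ q * n) N (N * n) p (p ^ C)
    (p ^ C * p * p * p) big shift (n ^ D) HG Hn eq_refl eq_refl eq_refl eq_refl eq_refl eq_refl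
    eq_refl eq_refl eq_refl hC_pow eq_refl eq_refl eq_refl eq_refl Hw_matrix Hw_weights) as F.
  pose proof (word_facts G q C D w w' n (num_edges G) k (n ^ q) (n ^ q * n) N (N * n) p (p ^ C)
    (p ^ C * p * p * p) big shift (n ^ D) HG Hn eq_refl eq_refl eq_refl eq_refl eq_refl eq_refl
    eq_refl eq_refl eq_refl hC_pow eq_refl eq_refl eq_refl eq_refl Hw_matrix Hw_weights) as U.
  intuition lia.
Qed.

Definition reduction_overhead : nat :=
  build_time q C D (num_edges G) N (N * n) + length (compile_block (decode_block q)).

Lemma reduction_run t s :
  halted P (run w' P t (init_state w' (encode G'))) ->
  output (run w' P t (init_state w' (encode G'))) = s ->
  length s = k ->
  exists t', t' <= reduction_overhead + 2 * t /\
    halted (reduction_program q C D P)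
      (run w (reduction_program q C D P) t' (init_state w (encode G))) /\
    output (run w (reduction_program q C D P) t' (init_state w (encode G))) =
      clique_answer G (map (top n q) s).
Proof.
  intros Hh Ho Hl.
  set (Q := reduction_program q C D P).
  set (build := compile_segs 0 (build_segs q C D)).
  pose proof (word_facts G q C D w w' n (num_edges G) k (n ^ q) (n ^ q * n) N (N * n) p (p ^ C)
    (p ^ C * p * p * p) big shift (n ^ D) HG Hn eq_refl eq_refl eq_refl eq_refl eq_refl eq_refl
    eq_refl eq_refl eq_refl hC_pow eq_refl eq_refl eq_refl eq_refl Hw_matrix Hw_weights) as U.
  destruct (build_correct G q C D w w' n (num_edges G) k (n ^ q) (n ^ q * n) N (N * n) p (p ^ C)
    (p ^ C * p * p * p) big shift (n ^ D) HG HW Hn eq_refl eq_refl eq_refl eq_refl eq_refl eq_refl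
    eq_refl eq_refl eq_refl hC_pow eq_refl eq_refl eq_refl eq_refl Hw_matrix Hw_weights)
    as (s1 & X1 & V1 & M1 & Mx1).
  destruct (compile_segs_correct w Q _ _ _ _ X1 0 (fun _ => 0%Z)) as (t1 & r1 & Ht1 & E1 & R1 & S1).
  { apply (code_at_mid []). }
  { intros x; reflexivity. }
  fold build in E1; cbn [Nat.add snd] in E1.
  change (run w Q t1 (init_state w (encode G)) = State (length build) r1 (snd s1)) in E1.
  set (base := length build) in *.
  (* The construction fixes all cells below H, and 2^w' = p^C <= H, so the whole memory of the
     simulated machine is in its initial state. *)
  assert (Hinit : simulated w' base (length P) (snd s1) (init_state w' (encode G'))
    (State base r1 (snd s1))).
  { constructor; cbn [pc regs mem init_state].
    - rewrite Nat.min_0_l; lia.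
    - exact S1.
    - intros _; pose proof (pow2_pos w'); lia.
    - intros a Ha; rewrite (proj2 (Z.ltb_ge _ _)) by lia.
      rewrite <- (Z2Nat.id a) at 1 by lia; apply M1.
      apply Nat.lt_le_trans with (p ^ C); [|apply U].
      rewrite hC_pow; apply Nat2Z.inj_lt; rewrite Z2Nat.id, Nat2Z.inj_pow by lia; apply Ha.
    - intros a Ha; destruct (a <? 0)%Z; [pose proof (pow2_pos w'); lia|apply wrap_range].
    - reflexivity. }
  destruct (simulate_run w w' P Q base 7 (snd s1) (init_state w' (encode G'))
    (State base r1 (snd s1)) t w'_le_w) as (t2 & Ht2 & V2 & Sim); [| |exact Hinit|].
  { apply code_at_mid. }
  { cbn [regs]; rewrite R1, (V1 7) by (cbn [length]; lia); cbn [nth].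
    rewrite hC_pow, Nat2Z.inj_sub, Nat2Z.inj_pow; [reflexivity|].
    pose proof (Nat.pow_nonzero 2 w'); lia. }
  rewrite <- E1, <- run_add in V2, Sim.
  set (sP := run w' P t (init_state w' (encode G'))) in *.
  destruct (run w Q (t1 + t2) (init_state w (encode G))) as [p2 r2 m2] eqn:E2.
  destruct Sim as [Spc _ _ Smem Srange Shigh]; cbn [pc regs mem] in *.
  unfold halted in Hh; rewrite Nat.min_r in Spc by exact Hh.
  pose proof (pow2_pos w') as Hpow.
  assert (Hk : Z.to_nat (mem sP 0%Z) = k).
  { rewrite <- Hl, <- Ho; unfold output; now rewrite length_map, length_seq. }
  (* Cell 0 holds k in a short word, so k < 2^w' and the output cells 1 to k lie inside the
     simulated memory. *)
  pose proof (Srange 0%Z ltac:(lia)) as R0.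
  assert (Hcells : forall i, i < k -> m2 (Z.of_nat (S i)) = Z.of_nat (nth i s 0)).
  { intros i Hi; rewrite Smem by lia.
    pose proof (Srange (Z.of_nat (S i)) ltac:(lia)) as Ri.
    rewrite <- Ho; unfold output; rewrite Hk, <- seq_shift, map_map, nth_map_seq by exact Hi.
    rewrite Z2Nat.id; lia. }
  assert (Hlt : forall i, i < k -> nth i s 0 < 2 ^ w).
  { intros i Hi; specialize (Hcells i Hi); rewrite Smem in Hcells by lia.
    pose proof (Srange (Z.of_nat (S i)) ltac:(lia)) as Ri; rewrite Hcells in Ri.
    apply Nat2Z.inj_lt; rewrite Nat2Z.inj_pow.
    eapply Z.lt_le_trans; [apply Ri|]; apply Z.pow_le_mono_r; pose proof w'_le_w; lia. }
  set (consts := [n; num_edges G; n ^ q; n ^ q * n; N; N * n; p; p ^ C - 1; p ^ C * p * p * p;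
    big; shift]) in *.
  set (v2 := fun x => r2 (var_reg x)).
  assert (Hv2 : vars_are consts (v2, m2)).
  { intros x Hx; cbn [fst]; unfold v2; rewrite V2; cbn [regs]; rewrite E1; cbn [regs].
    rewrite R1; exact (V1 x Hx). }
  (* The matrix survived the simulation because it starts at H >= 2^w'. *)
  assert (Hmx : matrix_holds n (p ^ C * p * p * p) G (snd (v2, m2))).
  { intros u v Hu Hv; cbn [snd]; rewrite Shigh; [now apply Mx1|].
    change 2%Z with (Z.of_nat 2); rewrite <- Nat2Z.inj_pow, <- hC_pow; lia. }
  pose proof (decode_correct G q C D w w' n (num_edges G) k (n ^ q) (n ^ q * n) N (N * n) p (p ^ C)
    (p ^ C * p * p * p) big shift (n ^ D) HG HW Hn eq_refl eq_refl eq_refl eq_refl eq_refl eq_refl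
    eq_refl eq_refl eq_refl hC_pow eq_refl eq_refl eq_refl eq_refl Hw_matrix Hw_weights s Hl Hlt
    (v2, m2) Hv2 Hmx Hcells) as Dec.
  destruct (compile_block_correct w Q (decode_block q) p2 r2 (v2, m2)) as (r3 & E3 & _ & _).
  { rewrite Spc; unfold Q, reduction_program; fold build.
    exists (build ++ translate base (var_reg 7) P), []; split.
    - now rewrite app_nil_r, <- app_assoc.
    - rewrite length_app; unfold translate; rewrite length_translate_from; reflexivity. }
  { intros x; reflexivity. }
  exists (t1 + t2 + length (compile_block (decode_block q))); split; [|split].
  - unfold reduction_overhead; lia.
  - rewrite run_add, E2; cbn [snd] in E3; rewrite E3; unfold halted; cbn [pc].
    unfold Q, reduction_program; rewrite !length_app; fold build.
    unfold translate; rewrite length_translate_from; fold base; lia.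
  - rewrite run_add, E2; cbn [snd] in E3; rewrite E3; exact Dec.
Qed.

End Run.

(** * Sizes and running times *)

(** N = k n^l has at most (1 + log2 k) + l (1 + log2 n) bits; the first summand is absorbed because
    1 + log2 n >= 1. *)
Lemma word_size_bound q n C D :
  1 <= n ->
  let k := 2 * S q + 1 in
  let p := 2 ^ S (Nat.log2 (k * (n ^ q * n))) in
  p ^ (C + D + 6) <= 2 ^ word_size ((S (Nat.log2 k) + S q) * (C + D + 6)) n.
Proof.
  intros Hn k p; unfold p, word_size; rewrite <- Nat.pow_mul_r.
  apply Nat.pow_le_mono_r; [lia|].
  set (L := S (Nat.log2 n)).
  assert (HN : k * (n ^ q * n) < 2 ^ (S (Nat.log2 k) + S q * L)).
  { rewrite Nat.pow_add_r, (Nat.mul_comm (S q)), Nat.pow_mul_r.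
    destruct (Nat.log2_spec k) as [_ Hk]; [unfold k; lia|].
    destruct (Nat.log2_spec n) as [_ Hn2]; [lia|]; fold L in Hn2.
    replace (n ^ q * n) with (n ^ S q) by (rewrite Nat.pow_succ_r'; ring).
    assert (n ^ S q <= (2 ^ L) ^ S q) by (apply Nat.pow_le_mono_l; lia).
    assert (1 <= n ^ S q) by (pose proof (Nat.pow_nonzero n (S q)); lia).
    apply Nat.lt_le_trans with (2 ^ S (Nat.log2 k) * n ^ S q).
    - apply Nat.mul_lt_mono_pos_r; lia.
    - apply Nat.mul_le_mono_l; assumption. }
  assert (Hpos : 0 < k * (n ^ q * n)).
  { pose proof (Nat.pow_nonzero n q ltac:(lia)); unfold k.
    apply Nat.mul_pos_pos; [lia|apply Nat.mul_pos_pos; lia]. }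
  apply Nat.log2_lt_pow2 in HN; [|exact Hpos].
  set (E := C + D + 6); set (a := S (Nat.log2 k)) in *.
  assert (S (Nat.log2 (k * (n ^ q * n))) <= (a + S q) * L).
  { apply Nat.le_trans with (a + S q * L); [lia|].
    rewrite Nat.mul_add_distr_r; assert (1 <= L) by (unfold L; lia); nia. }
  apply Nat.le_trans with ((a + S q) * L * E); [apply Nat.mul_le_mono_r; assumption|lia].
Qed.

(** The loops make O(log N + m + M) rounds of constant length. With m <= n^2, M = k n^(l+1) and l >=
    1, this is O(n^(2l)). *)
Lemma overhead_bound q C D : exists K, forall G, is_ugraph G -> 1 <= order G ->
  reduction_overhead G q C D <= K * order G ^ (2 * S q).
Proof.
  set (ls0 := loop_size (EOp OLt vp (EOp OAdd vN (EConst 1))) power_body).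
  set (ls1 := loop_size (EOp OLt ve vm) matrix_body).
  set (ls2 := loop_size (EOp OLt ve vM) (arc_body q)).
  set (l0 := length (compile_block (sizes_block q))).
  set (l1 := length (compile_block (constants_block C D))).
  set (l2 := length (compile_block header_block)).
  set (l3 := length (compile_block (decode_block q))).
  set (k := 2 * S q + 1).
  exists (l0 + (S k * ls0 + ls0) + l1 + (ls1 + ls1) + l2 + (k * ls2 + ls2) + l3).
  intros G HG Hn; unfold reduction_overhead, build_time.
  fold ls0 ls1 ls2 l0 l1 l2 l3 k.
  set (n := order G) in *.
  replace (n ^ q * n) with (n ^ S q) by (rewrite Nat.pow_succ_r'; ring).
  set (X := n ^ (2 * S q)).
  assert (Hmono : forall a, a <= 2 * S q -> n ^ a <= X)
    by (intros; apply Nat.pow_le_mono_r; lia).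
  assert (HX : 1 <= X) by (unfold X; pose proof (Nat.pow_nonzero n (2 * S q)); lia).
  assert (Hm : num_edges G <= X).
  { apply Nat.le_trans with (n * n); [now apply ugraph_num_edges|].
    replace (n * n) with (n ^ 2) by (cbn; lia); apply Hmono; lia. }
  assert (HN : S (Nat.log2 (k * n ^ S q)) <= S k * X).
  { pose proof (Nat.log2_le_lin (k * n ^ S q) ltac:(lia)).
    pose proof (Hmono (S q) ltac:(lia)); nia. }
  assert (HM : k * n ^ S q * n <= k * X).
  { replace (k * n ^ S q * n) with (k * n ^ S (S q)) by (rewrite (Nat.pow_succ_r' n (S q)); ring).
    apply Nat.mul_le_mono_l, Hmono; lia. }
  assert (T0 : S (Nat.log2 (k * n ^ S q)) * ls0 <= S k * X * ls0) by (apply Nat.mul_le_mono_r, HN).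
  assert (T1 : num_edges G * ls1 <= X * ls1) by (apply Nat.mul_le_mono_r, Hm).
  assert (T2 : k * n ^ S q * n * ls2 <= k * X * ls2) by (apply Nat.mul_le_mono_r, HM).
  assert (Hc : forall c, c <= c * X) by (intros; nia).
  pose proof (Hc l0); pose proof (Hc l1); pose proof (Hc l2); pose proof (Hc l3).
  pose proof (Hc ls0); pose proof (Hc ls1); pose proof (Hc ls2).
  clear - T0 T1 T2 H H0 H1 H2 H3 H4 H5.
  rewrite !Nat.mul_add_distr_r.
  replace (S k * ls0 * X) with (S k * X * ls0) by ring.
  replace (k * ls2 * X) with (k * X * ls2) by ring.
  replace (ls1 * X) with (X * ls1) in * by ring.
  lia.
Qed.

Open Scope R_scope.

Lemma npow_nat n e : (1 <= n)%nat -> npow n (INR e) = INR (n ^ e).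
Proof.
  intros Hn; unfold npow; rewrite pow_INR; apply Rpower_pow.
  apply lt_0_INR; lia.
Qed.

Lemma INR_ge_1 n : (1 <= n)%nat -> 1 <= INR n.
Proof. intros Hn; apply (le_INR 1) in Hn; exact Hn. Qed.

Lemma npow_layers k n l x :
  (1 <= k)%nat -> (1 <= n)%nat -> npow (k * n ^ l) x = npow k x * npow n (INR l * x).
Proof.
  intros Hk Hn; unfold npow at 1 2; rewrite mult_INR.
  pose proof (INR_ge_1 k Hk); pose proof (INR_ge_1 n Hn).
  rewrite <- (npow_nat n l Hn); unfold npow.
  rewrite <- Rpower_mult_distr, Rpower_mult; [reflexivity|lra|apply exp_pos].
Qed.

Lemma npow_pos n x : 0 < npow n x.
Proof. apply exp_pos. Qed.

(** The first term has exponent (l+1) + l(1-eps) = k - l eps, the second 2l = k - 1; [delta] is the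
    smaller of the two savings. *)
Lemma target_time_bound q eps n :
  (1 <= n)%nat -> 0 < eps ->
  let k := (2 * S q + 1)%nat in
  let delta := Rmin 1 (INR (S q) * eps) in
  INR (k * n ^ S (S q)) * npow (k * n ^ S q) (1 - eps) + INR (k * n ^ S q) ^ 2 <=
  (npow k (2 - eps) + INR k ^ 2) * npow n (INR k - delta).
Proof.
  intros Hn Heps k delta.
  assert (Hk : (1 <= k)%nat) by (unfold k; lia).
  pose proof (INR_ge_1 n Hn) as Hn1; pose proof (INR_ge_1 k Hk) as Hk1.
  assert (Hkl : INR k = 2 * INR (S q) + 1)
    by (unfold k; rewrite plus_INR, mult_INR; cbn [INR]; ring).
  rewrite Rmult_plus_distr_r; apply Rplus_le_compat.
  - rewrite npow_layers, mult_INR by assumption.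
    rewrite <- (npow_nat n (S (S q)) Hn).
    replace (npow k (2 - eps)) with (INR k * npow k (1 - eps)).
    + replace (INR k * npow n (INR (S (S q))) * (npow k (1 - eps) * npow n (INR (S q) * (1 - eps))))
        with (INR k * npow k (1 - eps) * (npow n (INR (S (S q))) * npow n (INR (S q) * (1 - eps))))
        by ring.
      apply Rmult_le_compat_l.
      * apply Rmult_le_pos; [lra|left; apply npow_pos].
      * unfold npow; rewrite <- Rpower_plus; apply Rle_Rpower; [exact Hn1|].
        unfold delta; pose proof (Rmin_r 1 (INR (S q) * eps)).
        rewrite (S_INR (S q)), Hkl; lra.
    + unfold npow; replace (2 - eps) with (1 + (1 - eps)) by ring.
      rewrite Rpower_plus, Rpower_1; lra.
  - rewrite mult_INR, Rpow_mult_distr; apply Rmult_le_compat_l; [apply pow_le; lra|].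
    rewrite <- pow_INR, <- Nat.pow_mul_r, <- npow_nat by exact Hn.
    apply Rle_Rpower; [exact Hn1|].
    unfold delta; pose proof (Rmin_l 1 (INR (S q) * eps)).
    rewrite mult_INR, Hkl; change (INR 2) with (1 + 1); lra.
Qed.

(** The real exponent of the weight bound is rounded up, because the program builds its price of a
    non-edge from an integer power. *)
Lemma weight_bound_nat n c x :
  (1 <= n)%nat -> IZR x <= npow n c -> (x <= Z.of_nat (n ^ Z.to_nat (up c)))%Z.
Proof.
  intros Hn Hx; apply le_IZR; rewrite <- INR_IZR_INZ, <- npow_nat by exact Hn.
  apply Rle_trans with (1 := Hx), Rle_Rpower; [now apply INR_ge_1|].
  destruct (archimed c) as [H _].
  rewrite INR_IZR_INZ; apply Rlt_le, Rlt_le_trans with (1 := H), IZR_le; lia.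
Qed.

(** * The layered graph as an instance of the cycle problems *)

Section Instance.

Variables (G : wgraph) (q D : nat).
Hypothesis HG : is_ugraph G.
Hypothesis Hn : (1 <= order G)%nat.
Hypothesis HW : forall u v x, In (u, v, x) (edges G) -> (1 <= x <= Z.of_nat (order G ^ D))%Z.

Let n := order G.
Let k := (2 * S q + 1)%nat.
Let N := (k * (n ^ q * n))%nat.
Let p := (2 ^ S (Nat.log2 N))%nat.
Let big := (p * p * p ^ D)%nat.
Let shift := (big * p * p * p)%nat.
Let G' := layered n q shift (clique_cost big G).

(** These inequalities do not mention the machine, so the earlier section is instantiated with
    [C = 0] and a word length that is long enough. *)
Lemma instance_facts :
  (3 <= N /\ p <= 2 * N /\ k * k * n ^ D < big /\ k * k * big < shift)%nat.
Proof.
  apply (arithmetic_facts G q 0 D (word_size ((S (Nat.log2 k) + S q) * (0 + D + 6)) n) HG Hn).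
  apply word_size_bound, Hn.
Qed.

(** N^(1+1/l) = k^(1+1/l) n^(l+1), so the k n^(l+1) arcs are exactly k^(-1/l) times this, and the
    two density constants coincide. *)
Lemma layered_sparse :
  sparse_digraph (S q) (npow k (- (1 / INR (S q)))) (npow k (- (1 / INR (S q)))) (2 * (D + 6)) G'.
Proof.
  assert (Hk : (1 <= k)%nat) by (unfold k; lia).
  assert (Hl : INR (S q) <> 0) by (apply not_0_INR; lia).
  split; [now apply is_digraph_layered|]; split.
  - assert (E : npow k (- (1 / INR (S q))) * npow (order G') (1 + 1 / INR (S q)) =
      INR (num_edges G')); [|rewrite E; lra].
    unfold G', num_edges; cbn [order edges layered]; rewrite length_map, length_seq; fold k.
    rewrite npow_layers by assumption.
    replace (INR (S q) * (1 + 1 / INR (S q))) with (INR (S (S q)))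
      by (rewrite (S_INR (S q)); field; exact Hl).
    rewrite npow_nat, mult_INR, <- Rmult_assoc by exact Hn; f_equal.
    unfold npow; rewrite <- Rpower_plus.
    replace (- (1 / INR (S q)) + (1 + 1 / INR (S q))) with 1 by ring.
    apply Rpower_1; pose proof (INR_ge_1 k Hk); lra.
  - intros u v x Hi; apply layered_edge in Hi as [_ ->]; [|exact Hn].
    destruct instance_facts as (F1 & F2 & F3 & F4).
    rewrite Z.abs_eq by lia; rewrite <- Nat2Z.inj_pow; apply Nat2Z.inj_le.
    assert (EN : order G' = N).
    { unfold G', N; cbn [order layered]; fold k; rewrite Nat.pow_succ_r'; ring. }
    rewrite EN.
    assert (HS : (sum_n (S q) (fun i => clique_cost big G (top n q u) (digit n i (v mod n ^ S q)))
      <= S q * big)%nat).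
    { apply sum_n_le; intros; apply (cost_le G _ HW big q); exact F3. }
    assert (HB : (S q * big <= k * k * big)%nat)
      by (apply Nat.mul_le_mono_r; clear; unfold k; nia).
    assert (Hpp : (2 <= p)%nat).
    { unfold p; rewrite Nat.pow_succ_r'; pose proof (Nat.pow_nonzero 2 (Nat.log2 N)); lia. }
    (* A weight is at most shift + l big < 2 shift <= p shift = p^(D+6). With p <= 2N <= N^2 this
       gives the degree 2(D+6). *)
    apply Nat.le_trans with (p * shift)%nat.
    + unfold lweight; clear - HS HB F4 Hpp; nia.
    + replace (p * shift)%nat with (p ^ (D + 6))%nat
        by (unfold shift, big; rewrite Nat.pow_add_r; cbn; ring).
      rewrite Nat.pow_mul_r, Nat.pow_2_r; apply Nat.pow_le_mono_l.
      apply Nat.le_trans with (1 := F2), Nat.mul_le_mono_r; lia.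
Qed.

Lemma layered_no_negative_cycle : no_negative_cycle G'.
Proof.
  intros s Hs; eapply Z.le_trans; [|apply cycle_weight_ge; [exact Hn|exact Hs]]; lia.
Qed.

End Instance.

(** What both problems provide on the constructed graphs: a minimum-weight k-cycle within the target
    time. *)
Definition cycle_solver (q D : nat) (eps : R) (P : program) (C : nat) (K : R) : Prop :=
  forall G, is_ugraph G -> (1 <= order G)%nat ->
  (forall u v x, In (u, v, x) (edges G) -> (1 <= x <= Z.of_nat (order G ^ D))%Z) ->
  let n := order G in
  let k := (2 * S q + 1)%nat in
  let N := (k * (n ^ q * n))%nat in
  let p := (2 ^ S (Nat.log2 N))%nat in
  let big := (p * p * p ^ D)%nat in
  let shift := (big * p * p * p)%nat in
  let G' := layered n q shift (clique_cost big G) in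
  let w' := word_size C N in
  exists t, INR t <= K * target_time eps G' /\
    halted P (run w' P t (init_state w' (encode G'))) /\
    min_solution (fun s => directed_cycle G' s /\ length s = k) (cycle_weight G')
      (output (run w' P t (init_state w' (encode G')))).

Lemma cycle_solver_exists q D eps :
  min_weight_k_cycle_fast (2 * S q + 1) (S q) eps \/ shortest_cycle_fast (S q) eps ->
  exists P C K, cycle_solver q D eps P C K.
Proof.
  set (a := npow (2 * S q + 1) (- (1 / INR (S q)))).
  intros [H|H]; destruct (H a a (2 * (D + 6))%nat (npow_pos _ _) (Rle_refl _)) as (P & C & K & HP);
    exists P, C, K; intros G HG Hn HW n k N p big shift G' w';
    assert (EN : order G' = N)
      by (unfold G', N, k; cbn [order layered]; rewrite Nat.pow_succ_r'; ring);
    assert (HN : (1 <= order G')%nat)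
      by (rewrite EN; destruct (instance_facts G q D HG Hn) as [F _]; fold n k N in F; lia).
  - destruct (HP G' HN) as (t & Ht & Hh & Hc); [now apply layered_sparse|].
    rewrite EN in Hh, Hc; exists t; auto.
  - destruct (HP G' HN) as (t & Ht & Hh & Hc);
      [split; [now apply layered_sparse|now apply layered_no_negative_cycle]|].
    rewrite EN in Hh, Hc; exists t; split; [exact Ht|]; split; [exact Hh|].
    destruct (instance_facts G q D HG Hn) as (_ & _ & F3 & F4).
    now apply (shortest_cycle_is_k_cycle G _ HW big q F3 shift Hn F4).
Qed.

Lemma clique_hypothesis_fails q eps :
  0 < eps ->
  min_weight_k_cycle_fast (2 * S q + 1) (S q) eps \/ shortest_cycle_fast (S q) eps ->
  ~ min_weight_k_clique_hypothesis (2 * S q + 1).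
Proof.
  intros heps Hfast (c & Hc & Hhyp).
  set (k := (2 * S q + 1)%nat) in *.
  set (D := Z.to_nat (up (c * INR k))).
  destruct (cycle_solver_exists q D eps Hfast) as (P & C & K & HP).
  destruct (overhead_bound q C D) as [Kb HKb].
  set (delta := Rmin 1 (INR (S q) * eps)).
  assert (Hdelta : 0 < delta).
  { apply Rmin_pos; [lra|]; apply Rmult_lt_0_compat; [apply lt_0_INR; lia|exact heps]. }
  apply (Hhyp delta Hdelta).
  (* The factor 2 is the slowdown of the simulation. The given constant [K] may have any sign and is
     replaced by [Rmax 0 K], so that multiplication by it preserves inequalities. *)
  exists (reduction_program q C D P), ((S (Nat.log2 k) + S q) * (C + D + 6))%nat,
    (INR Kb + 2 * (Rmax 0 K * (npow k (2 - eps) + INR k ^ 2))).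
  intros G Hn [HG Hx] w.
  assert (HW : forall u v x, In (u, v, x) (edges G) -> (1 <= x <= Z.of_nat (order G ^ D))%Z).
  { intros u v x Hi; destruct (Hx u v x Hi) as [H1 H2]; split; [exact H1|].
    now apply weight_bound_nat. }
  destruct (HP G HG Hn HW) as (t & Ht & Hh & Hm).
  destruct (instance_facts G q D HG Hn) as (_ & _ & F3 & F4).
  destruct (k_cycle_answer G _ HW HG _ q F3 _ Hn F4 _ Hm) as (HL & Hans).
  destruct (reduction_run G q C D w P HG Hn HW (word_size_bound q (order G) C D Hn) t _ Hh
    eq_refl HL) as (t' & Ht' & Hh' & Ho').
  exists t'; split; [|split; [exact Hh'|rewrite Ho'; exact Hans]].
  set (n := order G) in *.
  assert (Hov : INR (reduction_overhead G q C D) <= INR Kb * npow n (INR k - delta)).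
  { apply Rle_trans with (INR (Kb * n ^ (2 * S q))); [now apply le_INR, HKb|].
    rewrite mult_INR; apply Rmult_le_compat_l; [apply pos_INR|].
    rewrite <- npow_nat by exact Hn; apply Rle_Rpower; [now apply INR_ge_1|].
    unfold k; rewrite plus_INR; pose proof (Rmin_l 1 (INR (S q) * eps)).
    fold delta in H; change (INR 1) with 1; lra. }
  assert (Htt : INR t <= Rmax 0 K * ((npow k (2 - eps) + INR k ^ 2) * npow n (INR k - delta))).
  { apply Rle_trans with (1 := Ht).
    pose proof (target_time_bound q eps n Hn heps) as B; cbv zeta in B; fold k delta in B.
    unfold target_time, num_edges; cbn [order edges layered]; rewrite length_map, length_seq.
    fold k; set (T := _ + _) in B |- *.
    assert (0 <= T).
    { apply Rplus_le_le_0_compat; [apply Rmult_le_pos; [apply pos_INR|left; apply npow_pos]|].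
      apply pow_le, pos_INR. }
    apply Rle_trans with (Rmax 0 K * T).
    - apply Rmult_le_compat_r; [assumption|apply Rmax_r].
    - apply Rmult_le_compat_l; [apply Rmax_l|exact B]. }
  apply le_INR in Ht'; rewrite plus_INR, mult_INR in Ht'; change (INR 2) with (1 + 1) in Ht'.
  rewrite Rmult_plus_distr_r, !Rmult_assoc; lra.
Qed.

Close Scope R_scope.

Theorem theorem1p2 (l : nat) (eps : R) (hl : 1 <= l) (heps : (0 < eps)%R) :
  min_weight_k_cycle_fast (2 * l + 1) l eps \/ shortest_cycle_fast l eps ->
  ~ min_weight_k_clique_hypothesis (2 * l + 1).
Proof.
  destruct l as [|q]; [lia|]; exact (clique_hypothesis_fails q eps heps).
Qed.
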